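(* Let $s\ge 1$ and let $C\in L^\infty(D)$. For every $T>0$ there exists a constant $L(T)$, independent of $N$, such that the following holds for any initial data $u_0, v\in H^s_p(D)$. Let $u\in X_s$ be the solution of the linear peridynamic initial-value problem with periodic boundary conditions $$\rho\,u_{tt}(x,t)=g(u)(x,t)+b(x,t),\quad x\in D,\ 0\le t\le T,\qquad u(x,0)=u_0(x),\quad u_t(x,0)=v(x),$$ and let $u^N$, with $u^N(\cdot,t)\in S_N$ for every $0\le t\le T$, be the solution of the semi-discrete Fourier spectral scheme $$\rho\,u^N_{tt}=P_N g(u^N)+P_N b,\qquad u^N(x,0)=P_Nu_0(x),\quad u^N_t(x,0)=P_Nv(x).$$ Then $$\|u-u^N\|_{X_1}\le L(T)\,N^{1-s}\,\|u\|_{X_s}.$$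
   Context: Fix $M>0$ and let $D=[-M\pi,M\pi]$. $N>0$ is an even integer. $\rho>0$ is a constant (mass density). The micromodulus function $C:\mathbb{R}\to\mathbb{R}$ is nonnegative and even, $C(\xi)=C(-\xi)$, and vanishes outside $D$. The external force $b:D\times[0,T]\to\mathbb{R}$ is a given function, continuous in time with values in $L^2(D)$. All functions $u$, $u^N$, $u_0$, $v$, $b$ are real-valued. The integral operator $g$ is $$g(u)(x,t)=\int_D C(\hat x-x)\,\bigl(u(\hat x,t)-u(x,t)\bigr)\,d\hat x,\qquad x\in D,\ 0\le t\le T.$$ $H^s_p(D)$ denotes the $L^2$-based periodic Sobolev space of order $s$ on $D$ (functions periodic with period $2M\pi$). For $T>0$, $X_s=C^1([0,T];H^s_p(D))$, with norm $$\|u\|_{X_s}^2=\max_{t\in[0,T]}\left(\|u(\cdot,t)\|_{H^s_p(D)}^2+\|u_t(\cdot,t)\|_{H^s_p(D)}^2\right).$$ $S_N=\mathrm{span}\{e^{ikx/M} : -N\le k\le N\}$ is the space of trigonometric polynomials of degree $N$ on $D$, where $i=\sqrt{-1}$, and $P_N:L^2(D)\to S_N$ is the $L^2(D)$-orthogonal projection, i.e. $\int_D (u-P_Nu)\varphi\,dx=0$ for every $\varphi\in S_N$; for functions of $(x,t)$ it acts in the variable $x$. *)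

(* Defs.v *)
From HB Require Import structures.
From mathcomp Require Import all_boot all_order all_algebra.
From mathcomp Require Import all_classical all_reals all_analysis.
From mathcomp Require Import complex.
Set Implicit Arguments.
Unset Strict Implicit.
Unset Printing Implicit Defensive.
Import Order.TTheory GRing.Theory Num.Theory.
Import numFieldNormedType.Exports.

Local Open Scope classical_set_scope.
Local Open Scope complex_scope.
Local Open Scope ring_scope.

(* Conventions.
   - An element of a space of functions on D is represented by a function
     R -> R of which only the restriction to D matters, up to null sets.
   - A function of space and time is a curve u : R -> R -> R, time first, so
     that u t is the function x |-> u(x,t); only 0 <= t <= T matters.
   - Norms take values in \bar R and are used on measurable functions. *)

Section definitions.
Context {R : realType}.
Implicit Types (M s T rho t x : R) (f : R -> R) (u b : R -> R -> R).

Local Notation mu := (@lebesgue_measure R).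

Definition domain M : set R := `[- (M * pi), M * pi].

Definition eq_on_domain M (f1 f2 : R -> R) : Prop :=
  ae_eq mu (domain M) f1 f2.

Definition in_L2 M f : Prop := f \_ (domain M) \in Lfun mu 2%:E.

Definition in_Linfty M f : Prop := f \_ (domain M) \in Lfun mu +oo%E.

Definition L2norm M f : \bar R := 'N[mu]_2%:E[EFin \o (f \_ (domain M))]%E.

Definition cintegral (A : set R) (f : R -> R[i]) : R[i] :=
  (\int[mu]_(x in A) complex.Re (f x)) +i* (\int[mu]_(x in A) complex.Im (f x)).

(* e^{ikx/M} *)
Definition fourier_mode M (k : int) x : R[i] :=
  cos (k%:~R * x / M) +i* sin (k%:~R * x / M).

Definition fourier_coef M f (k : int) : R[i] :=
  ((2 * M * pi)^-1)%:C
  * cintegral (domain M) (fun x => (f x)%:C * fourier_mode M (- k) x).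

(* The H^s_p(D) norm, for real s, with the Bessel weights of the wave numbers
   k/M; the factor 2 M pi makes it the L^2(D) norm for s = 0 and
   (|f|^2 + |f'|^2)^(1/2), with L^2(D) norms, for s = 1. *)
Definition Hnorm M s f : \bar R :=
  ((\esum_(k in [set: int])
      (2 * M * pi * (1 + (k%:~R / M) ^+ 2) `^ s
       * ComplexField.Normc.normc (fourier_coef M f k) ^+ 2)%:E) `^ 2^-1)%E.

Definition in_H M s f : Prop := in_L2 M f /\ (Hnorm M s f < +oo)%E.

(* One-sided at the end points of [0, T]. *)
Definition is_time_derivative (nrm : (R -> R) -> \bar R) T u t (w : R -> R) :
    Prop :=
  nrm (fun x => (u tau x - u t x) / (tau - t) - w x)
    @[tau --> within `[0, T] t^'] --> 0%E.

Definition time_continuous (nrm : (R -> R) -> \bar R) T u : Prop :=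
  forall t, t \in `[0, T] ->
  nrm (fun x => u tau x - u t x) @[tau --> within `[0, T] (nbhs t)] --> 0%E.

Definition time_differentiable M T u : Prop :=
  forall t, t \in `[0, T] ->
  exists2 w, in_L2 M w & is_time_derivative (L2norm M) T u t w.

(* u_t as an L^2(D)-valued curve, well defined up to null sets when
   [time_differentiable M T u] and 0 < T *)
Definition ddt M T u : R -> R -> R := fun t =>
  xget (fun=> 0)
    [set w | in_L2 M w /\ is_time_derivative (L2norm M) T u t w].

(* X_s = C^1([0,T]; H^s_p(D)) *)
Definition in_X M T s u : Prop :=
  [/\ forall t, t \in `[0, T] -> in_H M s (u t),
      forall t, t \in `[0, T] -> in_H M s (ddt M T u t),
      forall t, t \in `[0, T] ->
        is_time_derivative (Hnorm M s) T u t (ddt M T u t) &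
      time_continuous (Hnorm M s) T (ddt M T u)].

(* For u in X_s the supremum is a maximum. *)
Definition Xnorm M T s u : \bar R :=
  (ereal_sup [set Hnorm M s (u t) `^ 2 + Hnorm M s (ddt M T u t) `^ 2
             | t in `[0%R, T]] `^ 2^-1)%E.

Definition peridynamic M (C : R -> R) f : R -> R := fun x =>
  \int[mu]_(y in domain M) (C (y - x) * (f y - f x)).

(* S_N: complex trigonometric polynomials of degree N on D *)
Definition trig_space M (N : nat) : set (R -> R[i]) :=
  [set phi | exists c : 'I_(2 * N).+1 -> R[i], forall x, domain M x ->
     phi x = \sum_(j < (2 * N).+1) c j * fourier_mode M (j%:Z - N%:Z) x].

Definition in_S M (N : nat) f : Prop := trig_space M N (fun x => (f x)%:C).

Definition P_ M (N : nat) f : R -> R :=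
  xget (fun=> 0)
    [set p | in_S M N p /\
       forall phi, trig_space M N phi ->
         cintegral (domain M) (fun x => (f x - p x)%:C * phi x) = 0].

(* rho u_tt = F in L^2(D) for every t in [0,T], u(0) = u0, u_t(0) = v *)
Definition is_ivp_solution M T rho (F : R -> R -> R) (u0 v : R -> R) u : Prop :=
  [/\ time_differentiable M T u,
      time_differentiable M T (ddt M T u),
      forall t, t \in `[0, T] ->
        eq_on_domain M (fun x => rho * ddt M T (ddt M T u) t x) (F t),
      eq_on_domain M (u 0) u0 &
      eq_on_domain M (ddt M T u 0) v].

(* Periodicity in x is part of u(t) \in H^s_p(D). *)
Definition peridynamic_solution M T rho s (C : R -> R) b (u0 v : R -> R) u :
    Prop :=
  in_X M T s u /\
  is_ivp_solution M T rho (fun t x => peridynamic M C (u t) x + b t x) u0 v u.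

Definition spectral_solution M T rho (C : R -> R) b (u0 v : R -> R) (N : nat) u :
    Prop :=
  (forall t, t \in `[0, T] -> in_S M N (u t)) /\
  is_ivp_solution M T rho
    (fun t x => P_ M N (peridynamic M C (u t)) x + P_ M N (b t) x)
    (P_ M N u0) (P_ M N v) u.

End definitions.

(* Main.v *)
(** Write e = u - u^N. Below frequency N the scheme and the equation have the same
    forcing, so the Fourier coefficients of e satisfy rho e_k'' = (g e)_k with zero
    initial data for |k| <= N, while e_k = u_k for |k| > N. As C is bounded, g is
    bounded on L^2, and Bessel's inequality together with Parseval's turns this into
    a Gronwall inequality for the energy sum_(|k| <= N) |e_k|^2 + |e_k'|^2, forced by
    the L^2 tail of u, which is of order N^-s. The inverse inequality on S_N then
    costs one power of N. No H^1 stability of g is used: g does not even map H^1_p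
    to itself. Parseval's inequality needs the completeness of the trigonometric
    system, which is proved by approximating indicators of intervals by bounded
    trigonometric polynomials. *)

Require Import Defs.
From mathcomp Require Import all_boot all_order all_algebra.
From mathcomp Require Import all_classical all_reals all_analysis.
From mathcomp Require Import measurable_realfun ess_sup_inf.
From mathcomp Require Import complex ring lra zify.
Set Implicit Arguments.
Unset Strict Implicit.
Unset Printing Implicit Defensive.
Import Order.TTheory GRing.Theory Num.Theory.
Import numFieldNormedType.Exports.

Local Open Scope classical_set_scope.
Local Open Scope ring_scope.

(** The equations for the low modes of e do not close: [g] is not diagonal on D, so it couples them
    to the high modes of [u]. Hence the full L^2 norm of e, tail included, must return to
    coefficients, which is what Parseval is for. It is proved only for functions with an H^1
    coefficient bound, where the coefficients are absolutely summable and uniqueness of coefficients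
    suffices; this is available because s is at least 1. Derivatives chosen by [ddt] are fixed only
    up to null sets, so everything is compared coefficient by coefficient, and infinite norms are
    handled as bounds on symmetric partial sums, uniform in their length. Let w = 1 + (N/M)^2 and
    let A be the square of the X_s norm of [u]. The L^2 tail contributes w^(-s) A, turned by
    Gronwall into a factor Gamma. Passing to H^1 multiplies low modes by at most w, and the high
    modes give w^(1-s) A directly. So the squared error is at most (1 + Gamma) w^(1-s) A, and w >=
    (N/M)^2 yields the constant sqrt(1 + Gamma) M^(s-1). *)

Section periodic_domain.
Context {R : realType} (M : R).
Hypothesis M_gt0 : 0 < M.
Implicit Types (f g p q r : R -> R) (k : int) (x : R).

Local Notation mu := (@lebesgue_measure R).
Local Notation D := (domain M).
Local Notation per := (2 * M * pi).

(** * Square-integrable functions on [D] *)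

Definition sqint f : Prop :=
  measurable_fun D f /\ mu.-integrable D (EFin \o (fun x => f x ^+ 2)).

Lemma per_gt0 : 0 < per.
Proof. by rewrite !mulr_gt0// pi_gt0. Qed.

Lemma measurable_domain : measurable (D : set (measurableTypeR R)).
Proof. exact: measurable_itv. Qed.

Lemma lebesgue_domain : mu D = per%:E.
Proof.
rewrite /domain lebesgue_measure_itv/= lte_fin ifT; last first.
  by rewrite gtrN// mulr_gt0// pi_gt0.
by rewrite -EFinD; congr EFin; ring.
Qed.

Lemma integrable_domainD f g : mu.-integrable D (EFin \o f) ->
  mu.-integrable D (EFin \o g) ->
  mu.-integrable D (EFin \o (fun x => f x + g x)).
Proof. by move=> fi gi; have := integrableD measurable_domain fi gi. Qed.

Lemma integrable_domainZ a f : mu.-integrable D (EFin \o f) ->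
  mu.-integrable D (EFin \o (fun x => a * f x)).
Proof. by move=> fi; have := integrableZl measurable_domain a fi. Qed.

Lemma eq_integrable_domain f g : (forall x, D x -> f x = g x) ->
  mu.-integrable D (EFin \o f) -> mu.-integrable D (EFin \o g).
Proof.
move=> fg; apply: eq_integrable; first exact: measurable_domain.
by move=> x /set_mem /fg /= ->.
Qed.

Lemma integrable_cst a : mu.-integrable D (EFin \o (fun=> a)).
Proof.
apply/integrableP; split; first exact: measurable_cst.
rewrite (_ : (fun _ => _) = cst `|a|%:E)// integral_cst.
  by rewrite [X in (_ * X)%E]lebesgue_domain -EFinM ltry.
exact: measurable_domain.
Qed.

Lemma le_integrable_domain f g : measurable_fun D f ->
  (forall x, D x -> `|f x| <= g x) -> mu.-integrable D (EFin \o g) ->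
  mu.-integrable D (EFin \o f).
Proof.
move=> mf fg; apply: le_integrable; first exact: measurable_domain.
  exact/measurable_EFinP.
by move=> x Dx /=; rewrite lee_fin (le_trans (fg _ Dx))// ler_norm.
Qed.

Lemma bounded_integrable f (A : R) : measurable_fun D f ->
  (forall x, D x -> `|f x| <= A) -> mu.-integrable D (EFin \o f).
Proof. by move=> mf fA; apply: le_integrable_domain fA (integrable_cst A). Qed.

Lemma integrable_sqintM f g : sqint f -> sqint g ->
  mu.-integrable D (EFin \o (fun x => f x * g x)).
Proof.
move=> [mf f2] [mg g2].
apply: le_integrable_domain (integrable_domainD f2 g2).
  exact: measurable_funM.
by move=> x Dx; rewrite ler_norml; apply/andP; split; nra.
Qed.

Lemma sqintD f g : sqint f -> sqint g -> sqint (fun x => f x + g x).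
Proof.
move=> sf sg; have [mf f2] := sf; have [mg g2] := sg.
split; first exact: measurable_funD.
apply: (@eq_integrable_domain (fun x => f x ^+ 2 + (2 * (f x * g x) + g x ^+ 2))).
  by move=> x _; ring.
apply: integrable_domainD => //; apply: integrable_domainD => //.
by apply: integrable_domainZ; exact: integrable_sqintM.
Qed.

Lemma sqintZ a f : sqint f -> sqint (fun x => a * f x).
Proof.
move=> [mf f2]; split; first exact: measurable_funM.
apply: eq_integrable_domain (integrable_domainZ (a ^+ 2) f2) => x _.
by rewrite exprMn.
Qed.

Lemma eq_sqint f g : (forall x, D x -> f x = g x) -> sqint f -> sqint g.
Proof.
move=> fg [mf f2]; split.
  by apply: eq_measurable_fun mf => x /set_mem /fg.
by apply: eq_integrable_domain f2 => x /fg ->.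
Qed.

Lemma sqintB f g : sqint f -> sqint g -> sqint (fun x => f x - g x).
Proof.
move=> sf sg; apply: (@eq_sqint (fun x => f x + (-1) * g x)).
  by move=> x _; rewrite mulN1r.
by apply: sqintD => //; apply: sqintZ.
Qed.

Lemma bounded_sqint f (A : R) : measurable_fun D f ->
  (forall x, D x -> `|f x| <= A) -> sqint f.
Proof.
move=> mf fA; split=> //; apply: (@bounded_integrable _ (A ^+ 2)).
  exact: measurable_funX.
move=> x Dx; rewrite normrX lerXn2r ?nnegrE ?normr_ge0 ?fA//.
by rewrite (le_trans _ (fA _ Dx)).
Qed.

Lemma sqint_cst a : sqint (cst a).
Proof. by apply: (@bounded_sqint _ `|a|) => //; exact: measurable_cst. Qed.

Lemma sqint_sum (I : Type) (r : seq I) (F : I -> R -> R) :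
  (forall i, sqint (F i)) -> sqint (fun x => \sum_(i <- r) F i x).
Proof.
move=> sF; elim: r => [|i r IH].
  by apply: eq_sqint (sqint_cst 0) => x _; rewrite big_nil.
apply: eq_sqint (sqintD (sF i) IH) => x _; rewrite big_cons//.
Qed.

Lemma sqint_integrable f : sqint f -> mu.-integrable D (EFin \o f).
Proof.
move=> sf; have := integrable_sqintM sf (sqint_cst 1).
by congr integrable; apply/funext => x /=; rewrite mulr1.
Qed.

Lemma integrable_sqint_sqr f : sqint f ->
  mu.-integrable D (EFin \o (fun x => f x ^+ 2)).
Proof. by case. Qed.

Lemma ae_eq_Rintegral f g : measurable_fun D f -> measurable_fun D g ->
  ae_eq mu D f g -> \int[mu]_(x in D) f x = \int[mu]_(x in D) g x.
Proof.
move=> mf mg fg; congr fine; apply: ae_eq_integral => //.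
- exact: measurable_domain.
- exact/measurable_EFinP.
- exact/measurable_EFinP.
- by apply: filterS fg => x /= fg Dx; rewrite fg.
Qed.

Lemma cauchy_schwarz f g : sqint f -> sqint g ->
  0 < \int[mu]_(x in D) (g x ^+ 2) ->
  (\int[mu]_(x in D) (f x * g x)) ^+ 2 <=
  (\int[mu]_(x in D) (f x ^+ 2)) * (\int[mu]_(x in D) (g x ^+ 2)).
Proof.
move=> sf sg; set c := Rintegral mu D (fun x => g x ^+ 2) => c_gt0.
set a := Rintegral mu D (fun x => f x ^+ 2).
set b := Rintegral mu D (fun x => f x * g x).
have mD := measurable_domain; have fg := integrable_sqintM sf sg.
have f2 := integrable_sqint_sqr sf; have g2 := integrable_sqint_sqr sg.
have : 0 <= \int[mu]_(x in D) ((c * f x - b * g x) ^+ 2).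
  by apply: Rintegral_ge0 => x _; exact: sqr_ge0.
rewrite (@eq_Rintegral _ _ _ mu D (fun x => c ^+ 2 * f x ^+ 2 +
  ((- (2 * c * b)) * (f x * g x) + b ^+ 2 * g x ^+ 2))); last by move=> x _; ring.
rewrite !RintegralD//; do ?[exact: integrable_domainZ];
  last by apply: integrable_domainD; exact: integrable_domainZ.
rewrite !RintegralZl// -/a -/b -/c (_ : _ + _ = c * (a * c - b ^+ 2)); last by ring.
by rewrite pmulr_rge0// subr_ge0.
Qed.

Lemma integral_restrict_sqr f :
  (\int[mu]_x (`|((f \_ D) x)%:E| `^ 2) = \int[mu]_(x in D) (f x ^+ 2)%:E)%E.
Proof.
rewrite [RHS]integral_mkcond; apply: eq_integral => x _; rewrite restrict_EFin /=.
rewrite powR_mulrn// real_normK ?num_real//.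
by rewrite !patchE; case: ifP => //; rewrite expr2 mulr0.
Qed.

(** Bridge to the norm-based definition: [sqint] speaks of real integrals over [D], so later
    computations carry neither restrictions nor extended reals. *)
Lemma in_L2P f : in_L2 M f <-> sqint f.
Proof.
have mr : measurable_fun D f <-> measurable_fun setT (f \_ D).
  by apply: measurable_restrictT; exact: measurable_domain.
rewrite /in_L2 inE /= /finite_norm; split.
  move=> /andP[]; rewrite !inE/= => mf.
  rewrite /finite_norm unlock integral_restrict_sqr => fin.
  split; first exact/mr.
  apply/integrableP; split.
    by apply/measurable_EFinP/measurable_funX/mr.
  under eq_integral do rewrite /= ger0_norm ?sqr_ge0//.
  by apply: lty_poweRy fin; rewrite invr_eq0.
move=> [mf /integrableP[_ f2]]; apply/andP; rewrite !inE/=; split; first exact/mr.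
rewrite /finite_norm unlock integral_restrict_sqr poweR_lty//; move: f2.
by under eq_integral do rewrite /= ger0_norm ?sqr_ge0//.
Qed.

Lemma L2normE f : sqint f ->
  L2norm M f = (Num.sqrt (\int[mu]_(x in D) (f x ^+ 2)))%:E.
Proof.
move=> [mf f2]; rewrite /L2norm unlock integral_restrict_sqr.
rewrite -(fineK (integrable_fin_num measurable_domain f2)) poweR_EFin -powR12_sqrt//.
by apply: Rintegral_ge0 => x _; exact: sqr_ge0.
Qed.

Lemma L2normB f g : sqint f -> sqint g ->
  (L2norm M (fun x => f x - g x)%R <= L2norm M f + L2norm M g)%E.
Proof.
move=> [mf _] [mg _]; rewrite /L2norm.
have mr (h : R -> R) : measurable_fun D h -> measurable_fun setT (h \_ D).
  by move=> mh; apply: (measurable_restrictT _ _).1 => //; exact: measurable_domain.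
rewrite [X in (_ <= _ + X)%E](_ : _ = 'N[mu]_2%:E[EFin \o (\- (g \_ D))%R])%E; last first.
  by rewrite -oppe_Lnorm; apply: eq_Lnorm.
rewrite (_ : (fun x => f x - g x) \_ D = (f \_ D) \+ (\- (g \_ D))).
  apply: eminkowski; first exact: mr.
    by apply: measurableT_comp; [exact: oppr_measurable|exact: mr].
  by rewrite lee_fin ler1n.
by apply/funext => x /=; rewrite !patchE; case: ifP => //; rewrite subr0.
Qed.

(** * Real trigonometric system *)

(* The Hartley system is real, orthogonal and indexed by int; a weighted sum of
   squared coefficients with even weights is the same as for the complex Fourier
   coefficients, see [Hnorm_sqrD_le]. *)
Definition cas k x : R := cos (k%:~R * x / M) + sin (k%:~R * x / M).

Lemma cas0 x : cas 0 x = 1.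
Proof. by rewrite /cas !mul0r cos0 sin0 addr0. Qed.

Lemma cos_cas k x : cos (k%:~R * x / M) = (cas k x + cas (- k) x) / 2.
Proof. by rewrite /cas mulrNz !mulNr cosN sinN; field. Qed.

Lemma sin_cas k x : sin (k%:~R * x / M) = (cas k x - cas (- k) x) / 2.
Proof. by rewrite /cas mulrNz !mulNr cosN sinN; field. Qed.

(** Product-to-sum formula; it yields both the orthogonality of the system and the stability of
    trigonometric polynomials under products. *)
Lemma casM k l x : cas k x * cas l x =
  (cas (k - l) x + cas (l - k) x + cas (k + l) x - cas (- (k + l)) x) / 2.
Proof.
set a := k%:~R * x / M; set b := l%:~R * x / M.
have -> : cas (k - l) x = cos (a - b) + sin (a - b).
  by rewrite /cas rmorphB/= !mulrBl.
have -> : cas (l - k) x = cos (b - a) + sin (b - a).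
  by rewrite /cas rmorphB/= !mulrBl.
have -> : cas (k + l) x = cos (a + b) + sin (a + b).
  by rewrite /cas rmorphD/= !mulrDl.
have -> : cas (- (k + l)) x = cos (a + b) - sin (a + b).
  by rewrite /cas mulrNz rmorphD/= !mulNr !mulrDl cosN sinN.
by rewrite /cas -/a -/b !(cosB, sinB, cosD, sinD); field.
Qed.

Lemma cas_le2 k x : `|cas k x| <= 2.
Proof.
rewrite (le_trans (ler_normD _ _))// -[leRHS]/(1 + 1).
by rewrite lerD ?cos_max ?sin_max.
Qed.

Lemma continuous_scale_trig (h : R -> R) (a b : R) : continuous h ->
  continuous (fun x => h (a * x / b)).
Proof.
move=> ch x; apply: (@continuous_comp _ _ _ (fun x => a * x / b) h); last exact: ch.
by apply: cvgM; [apply: cvgM; [exact: cvg_cst|exact: cvg_id]|exact: cvg_cst].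
Qed.

Lemma continuous_cas k : continuous (cas k).
Proof.
move=> x; apply: cvgD; apply: continuous_scale_trig.
- exact: continuous_cos.
- exact: continuous_sin.
Qed.

Lemma measurable_cas k (A : set R) : measurable_fun A (cas k).
Proof.
apply: measurable_funTS; apply: continuous_measurable_fun.
exact: continuous_cas.
Qed.

Lemma sqint_cas k : sqint (cas k).
Proof.
apply: (@bounded_sqint _ 2) => [|x _]; first exact: measurable_cas.
exact: cas_le2.
Qed.

Lemma sin_int_pi k : sin (k%:~R * pi : R) = 0.
Proof.
have H n : sin (n%:R * pi : R) = 0.
  elim: n => [|n IH]; first by rewrite mul0r sin0.
  by rewrite -addn1 natrD mulrDl mul1r sinDpi IH oppr0.
case: k => n; first exact: H.
by rewrite NegzE mulrNz mulNr sinN H oppr0.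
Qed.

Lemma Rintegral_cas k : \int[mu]_(x in D) cas k x = per * (k == 0)%:R.
Proof.
have [->|k0] := eqVneq k 0.
  rewrite (@eq_Rintegral _ _ _ mu D (cst 1)); last by move=> x _; rewrite cas0.
  rewrite Rintegral_cst; last exact: measurable_domain.
  rewrite mul1r mulr1 -[RHS]/(fine per%:E); congr fine; exact: lebesgue_domain.
have kR0 : k%:~R != 0 :> R by rewrite intr_eq0.
have M0 : M != 0 by rewrite gt_eqF.
(* An antiderivative of [cas k]: at the two end points of [D] its cosines agree and its sines, taken
   at integer multiples of pi, vanish. *)
pose F x : R := M / k%:~R * (sin (k%:~R * x / M) - cos (k%:~R * x / M)).
have dF x : is_derive x 1 F (cas k x).
  have dl : is_derive x 1 (fun x : R => k%:~R * x / M) (k%:~R / M).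
    have -> : (fun x : R => k%:~R * x / M) = (fun x => (k%:~R / M) *: x).
      by apply/funext => y; rewrite /GRing.scale/=; ring.
    by apply: is_derive_eq; rewrite /GRing.scale/= mulr1.
  rewrite /F; apply: is_derive_eq.
  rewrite /cas /GRing.scale/=; field.
  by rewrite M0 kR0.
have cF : continuous F.
  move=> x; apply: differentiable_continuous; apply/derivable1_diffP.
  by have [] := dF x.
have MpN : - (M * pi) < M * pi by rewrite gtrN// mulr_gt0// pi_gt0.
have := @continuous_FTC2 R (cas k) F (- (M * pi)) (M * pi) MpN.
rewrite mulr0 /Rintegral => ->//=.
- rewrite /F !mulrN !mulNr cosN sinN.
  rewrite (_ : k%:~R * (M * pi) / M = k%:~R * pi); last by field.
  rewrite sin_int_pi; ring.
- apply: continuous_subspaceT; exact: continuous_cas.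
- split=> [x _||]; first by have [] := dF x.
  + by apply: cvg_at_right_filter; exact: cF.
  + by apply: cvg_at_left_filter; exact: cF.
- by move=> x _; rewrite derive1E; have [_ ->] := dF x.
Qed.

Lemma Rintegral_casM k l :
  \int[mu]_(x in D) (cas k x * cas l x) = per * (k == l)%:R.
Proof.
have ic j : mu.-integrable D (EFin \o cas j) by apply: sqint_integrable; exact: sqint_cas.
rewrite (@eq_Rintegral _ _ _ mu D (fun x => 2^-1 * cas (k - l) x +
  (2^-1 * cas (l - k) x + (2^-1 * cas (k + l) x + (- 2^-1) * cas (- (k + l)) x)))); last first.
  by move=> x _; rewrite casM; field.
have mD := measurable_domain.
rewrite !RintegralD//; do ?[exact: integrable_domainZ | apply: integrable_domainD].
(* The two terms of frequency k + l and -(k + l) have opposite signs and cancel; those of frequency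
   k - l and l - k add up. *)
rewrite !RintegralZl// !Rintegral_cas oppr_eq0 !subr_eq0 (eq_sym l).
by case: (k == l); case: (k + l == 0); field.
Qed.

(** * Symmetric sums over integer frequencies *)

Definition sumZ (n : nat) (F : int -> R) : R :=
  \sum_(j < (2 * n).+1) F (j%:Z - n%:Z).

Lemma sumZ0 F : sumZ 0 F = F 0.
Proof. by rewrite /sumZ muln0 big_ord_recl big_ord0 addr0. Qed.

Lemma sumZS n F : sumZ n.+1 F = F (- n.+1%:Z) + sumZ n F + F n.+1%:Z.
Proof.
rewrite /sumZ (_ : (2 * n.+1).+1 = ((2 * n).+1).+2)%N; last by lia.
rewrite big_ord_recl big_ord_recr /= -addrA; congr (_ + (_ + _)).
- by congr F; rewrite sub0r.
- by apply: eq_bigr => i _; congr F; rewrite /bump /=; lia.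
- by congr F; rewrite /bump /=; lia.
Qed.

Lemma eq_sumZ n F G : F =1 G -> sumZ n F = sumZ n G.
Proof. by move=> FG; apply: eq_bigr => i _. Qed.

Lemma le_sumZ n F G : (forall k, F k <= G k) -> sumZ n F <= sumZ n G.
Proof. by move=> FG; apply: ler_sum => i _. Qed.

Lemma sumZ_ge0 n F : (forall k, 0 <= F k) -> 0 <= sumZ n F.
Proof. by move=> F0; apply: sumr_ge0 => i _. Qed.

Lemma sumZD n F G : sumZ n (fun k => F k + G k) = sumZ n F + sumZ n G.
Proof. exact: big_split. Qed.

Lemma sumZZ n a F : sumZ n (fun k => a * F k) = a * sumZ n F.
Proof. by rewrite /sumZ mulr_sumr. Qed.

Lemma sumZ_delta n (c : int -> R) k :
  sumZ n (fun l => c l * (l == k)%:R) = if (`|k| <= n)%N then c k else 0.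
Proof.
elim: n => [|n IH].
  rewrite sumZ0 leqn0 absz_eq0 eq_sym; case: eqVneq => [->|_] /=; first by rewrite mulr1.
  by rewrite mulr0.
rewrite sumZS IH; have [kn|kn] := leqP `|k|%N n.
  rewrite (leqW kn) (_ : (- n.+1%:Z == k) = false); last by apply/negbTE; lia.
  rewrite (_ : (n.+1%:Z == k) = false) ?mulr0 ?addr0 ?add0r//.
  by apply/negbTE; lia.
have [->|/negbTE n1] := eqVneq k n.+1%:Z.
  rewrite mulr1 (_ : (- n.+1%:Z == n.+1%:Z) = false); last by apply/negbTE; lia.
  by rewrite mulr0 !add0r absz_nat leqnn.
have [->|/negbTE n2] := eqVneq k (- n.+1%:Z).
  by rewrite mulr1 mulr0 !addr0 abszN absz_nat leqnn.
rewrite !mulr0 !addr0 ifF//.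
by apply/negbTE; lia.
Qed.

(** No order between [n] and [m] is assumed: for n <= m nonnegativity decides, for n > m the extra
    terms vanish. *)
Lemma sumZ_supp_le n m F : (forall k, 0 <= F k) ->
  (forall k, (m < `|k|)%N -> F k = 0) -> sumZ n F <= sumZ m F.
Proof.
move=> F0 Fm.
have inc i j : (i <= j)%N -> sumZ i F <= sumZ j F.
  elim: j => [|j IH]; first by rewrite leqn0 => /eqP ->.
  rewrite leq_eqVlt => /predU1P[->//|]; rewrite ltnS => /IH ij.
  by rewrite sumZS (le_trans ij)// -addrA addrCA lerDl addr_ge0.
have [/inc//|/ltnW mn] := leqP n m.
elim: n mn => [|n IH]; first by rewrite leqn0 => /eqP ->.
rewrite leq_eqVlt => /predU1P[->//|]; rewrite ltnS => mn.
rewrite sumZS !Fm ?add0r ?addr0 ?IH//; by rewrite ?abszN absz_nat ltnS.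
Qed.

(** * Hartley coefficients and Bessel's inequality *)

Definition hcoef f k : R := per^-1 * \int[mu]_(x in D) (f x * cas k x).

Lemma per_hcoef f k : per * hcoef f k = \int[mu]_(x in D) (f x * cas k x).
Proof. by rewrite /hcoef mulrA mulfV ?mul1r// gt_eqF// per_gt0. Qed.

Lemma integrable_cas f k : sqint f ->
  mu.-integrable D (EFin \o (fun x => f x * cas k x)).
Proof. by move=> sf; apply: integrable_sqintM => //; exact: sqint_cas. Qed.

Lemma hcoefD f g k : sqint f -> sqint g ->
  hcoef (fun x => f x + g x) k = hcoef f k + hcoef g k.
Proof.
move=> sf sg; rewrite /hcoef -mulrDr -RintegralD; first last.
- exact: integrable_cas.
- exact: integrable_cas.
- exact: measurable_domain.
by congr (_ * _); apply: eq_Rintegral => x _; rewrite mulrDl.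
Qed.

Lemma hcoefZ a f k : sqint f -> hcoef (fun x => a * f x) k = a * hcoef f k.
Proof.
move=> sf; rewrite /hcoef mulrCA; congr (_ * _); rewrite -RintegralZl; first last.
- exact: integrable_cas.
- exact: measurable_domain.
by apply: eq_Rintegral => x _; rewrite mulrA.
Qed.

Lemma hcoefB f g k : sqint f -> sqint g ->
  hcoef (fun x => f x - g x) k = hcoef f k - hcoef g k.
Proof.
move=> sf sg; rewrite -[in RHS](mulN1r (hcoef g k)) -hcoefZ// -hcoefD//; last exact: sqintZ.
by congr (_ * _); apply: eq_Rintegral => x _; rewrite mulN1r.
Qed.

Lemma eq_hcoef f g k : (forall x, D x -> f x = g x) -> hcoef f k = hcoef g k.
Proof.
by move=> fg; congr (_ * _); apply: eq_Rintegral => x /set_mem Dx; rewrite fg.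
Qed.

Lemma ae_hcoef f g k : sqint f -> sqint g -> ae_eq mu D f g -> hcoef f k = hcoef g k.
Proof.
move=> [mf _] [mg _] fg; congr (_ * _); apply: ae_eq_Rintegral.
- by apply: measurable_funM => //; exact: measurable_cas.
- by apply: measurable_funM => //; exact: measurable_cas.
- by apply: filterS fg => x /= fg Dx; rewrite fg.
Qed.

Lemma hcoef_cas l k : hcoef (cas l) k = (l == k)%:R.
Proof. by rewrite /hcoef Rintegral_casM mulrA mulVf ?mul1r// gt_eqF// per_gt0. Qed.

Definition cas_sum n (c : int -> R) x : R := sumZ n (fun k => c k * cas k x).

Lemma sqint_cas_sum n c : sqint (cas_sum n c).
Proof. by apply: sqint_sum => i; apply: sqintZ; exact: sqint_cas. Qed.

Lemma hcoef_sum (I : Type) (r : seq I) (F : I -> R -> R) k :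
  (forall i, sqint (F i)) ->
  hcoef (fun x => \sum_(i <- r) F i x) k = \sum_(i <- r) hcoef (F i) k.
Proof.
move=> sF; elim: r => [|i r IH].
  rewrite big_nil (@eq_hcoef _ (fun x => 0 * 0)) => [|x _]; last by rewrite big_nil mul0r.
  by rewrite hcoefZ ?mul0r//; exact: sqint_cst.
rewrite big_cons -IH -hcoefD//; last exact: sqint_sum.
by apply: eq_hcoef => x _; rewrite big_cons.
Qed.

Lemma hcoef_cas_sum n c k :
  hcoef (cas_sum n c) k = if (`|k| <= n)%N then c k else 0.
Proof.
rewrite hcoef_sum => [|i]; last by apply: sqintZ; exact: sqint_cas.
rewrite -sumZ_delta; apply: eq_bigr => i _.
by rewrite hcoefZ ?hcoef_cas//; exact: sqint_cas.
Qed.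

Lemma Rintegral_cas_sumM f n c : sqint f ->
  \int[mu]_(x in D) (f x * cas_sum n c x) = per * sumZ n (fun k => c k * hcoef f k).
Proof.
move=> sf; rewrite /cas_sum /sumZ.
elim: index_enum => [|i r IH].
  rewrite big_nil mulr0 (@eq_Rintegral _ _ _ mu D (cst 0)) => [|x _]; last first.
    by rewrite big_nil mulr0.
  by rewrite Rintegral_cst ?mul0r//; exact: measurable_domain.
rewrite big_cons mulrDr -IH mulrCA per_hcoef -RintegralZl; first last.
- exact: integrable_cas.
- exact: measurable_domain.
rewrite -RintegralD.
- by apply: eq_Rintegral => x _; rewrite big_cons mulrDr mulrCA.
- exact: measurable_domain.
- by apply: integrable_domainZ; exact: integrable_cas.
- apply: integrable_sqintM => //; apply: sqint_sum => j.
  by apply: sqintZ; exact: sqint_cas.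
Qed.

Lemma Rintegral_cas_sum_sqr n c :
  \int[mu]_(x in D) (cas_sum n c x ^+ 2) = per * sumZ n (fun k => c k ^+ 2).
Proof.
rewrite (@eq_Rintegral _ _ _ mu D (fun x => cas_sum n c x * cas_sum n c x)); last first.
  by move=> x _; rewrite expr2.
rewrite Rintegral_cas_sumM; last exact: sqint_cas_sum.
congr (_ * _); apply: eq_bigr => i _; rewrite hcoef_cas_sum expr2 ifT//.
by have := ltn_ord i; lia.
Qed.

Lemma bessel f n : sqint f ->
  per * sumZ n (fun k => hcoef f k ^+ 2) <= \int[mu]_(x in D) (f x ^+ 2).
Proof.
move=> sf; set S := cas_sum n (hcoef f); have sS : sqint S by exact: sqint_cas_sum.
have mD := measurable_domain.
(* For the partial sum S of f, the integrals of f S and of S^2 are both [per] times the sum of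
   squared coefficients. *)
have : 0 <= \int[mu]_(x in D) ((f x - S x) ^+ 2).
  by apply: Rintegral_ge0 => x _; exact: sqr_ge0.
rewrite (@eq_Rintegral _ _ _ mu D (fun x => f x ^+ 2 + ((-2) * (f x * S x) + S x ^+ 2))); last first.
  by move=> x _; ring.
have i1 := integrable_sqint_sqr sf; have i2 := integrable_sqint_sqr sS.
have i3 := integrable_sqintM sf sS; have i4 := integrable_domainZ (-2) i3.
rewrite !RintegralD//; last exact: integrable_domainD.
rewrite RintegralZl// Rintegral_cas_sumM// Rintegral_cas_sum_sqr.
rewrite (@eq_sumZ n (fun k => hcoef f k * hcoef f k) (fun k => hcoef f k ^+ 2)) => [|k]; last first.
  by rewrite expr2.
lra.
Qed.

(** * Completeness *)

Lemma dominated_Rintegral (F : nat -> R -> R) (G g : R -> R) :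
  (forall n, measurable_fun D (F n)) -> measurable_fun D G ->
  {ae mu, forall x, D x -> F ^~ x @ \oo --> G x} ->
  mu.-integrable D (EFin \o g) ->
  (forall n x, D x -> `|F n x| <= g x) ->
  mu.-integrable D (EFin \o G) /\
  (fun n => \int[mu]_(x in D) F n x) @ \oo --> \int[mu]_(x in D) G x.
Proof.
move=> mF mG FG ig Fg.
have [||||| iG _ h] := @dominated_convergence _ _ _ mu D measurable_domain
  (fun n => EFin \o F n) (EFin \o G) (EFin \o g).
- by move=> n; apply/measurable_EFinP; exact: mF.
- by apply/measurable_EFinP; exact: mG.
- apply: filterS FG; first exact: (ae_filter_ringOfSetsType mu).
  by move=> x /= FG Dx; apply/fine_cvgP; split; [exact: nearW|exact: FG].
- exact: ig.
- by apply/aeW => x n Dx /=; rewrite lee_fin Fg.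
split=> //; rewrite /Rintegral; apply: fine_cvg.
by rewrite fineK//; apply: integrable_fin_num iG; exact: measurable_domain.
Qed.

(** The degree is deliberately not recorded: the approximants below have degree growing
    exponentially, and only closure under products and powers matters. *)
Inductive trigpoly : (R -> R) -> Prop :=
| trigpoly_cas k : trigpoly (cas k)
| trigpolyD p q : trigpoly p -> trigpoly q -> trigpoly (fun x => p x + q x)
| trigpolyZ a p : trigpoly p -> trigpoly (fun x => a * p x).

Lemma trigpoly_eq p q : trigpoly p -> p =1 q -> trigpoly q.
Proof. by move=> tp /funext <-. Qed.

Lemma trigpoly_cst a : trigpoly (fun=> a).
Proof.
by apply: trigpoly_eq (trigpolyZ a (trigpoly_cas 0)) _ => x; rewrite cas0 mulr1.
Qed.

Lemma trigpolyM p q : trigpoly p -> trigpoly q -> trigpoly (fun x => p x * q x).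
Proof.
move=> tp tq; elim: tp => [k|p1 p2 _ h1 _ h2|a p1 _ h1].
- elim: tq => [l|q1 q2 _ h1 _ h2|a q1 _ h1].
  + apply: (@trigpoly_eq (fun x => 2^-1 * (cas (k - l) x + cas (l - k) x +
       (cas (k + l) x + (-1) * cas (- (k + l)) x)))).
      apply: trigpolyZ; apply: trigpolyD; apply: trigpolyD; try exact: trigpoly_cas.
      by apply: trigpolyZ; exact: trigpoly_cas.
    by move=> x; rewrite casM; field.
  + by apply: trigpoly_eq (trigpolyD h1 h2) _ => x; rewrite mulrDr.
  + by apply: trigpoly_eq (trigpolyZ a h1) _ => x; rewrite mulrCA.
- by apply: trigpoly_eq (trigpolyD h1 h2) _ => x; rewrite mulrDl.
- by apply: trigpoly_eq (trigpolyZ a h1) _ => x; rewrite mulrA.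
Qed.

Lemma trigpolyX p n : trigpoly p -> trigpoly (fun x => p x ^+ n).
Proof.
move=> tp; elim: n => [|n IH].
  by apply: trigpoly_eq (trigpoly_cst 1) _ => x; rewrite expr0.
by apply: trigpoly_eq (trigpolyM tp IH) _ => x; rewrite exprS.
Qed.

Lemma measurable_trigpoly p : trigpoly p -> measurable_fun D p.
Proof.
elim=> [k|p1 p2 _ h1 _ h2|a p1 _ h1]; first exact: measurable_cas.
- exact: measurable_funD.
- exact: measurable_funM.
Qed.

Lemma trigpoly_bounded p : trigpoly p -> exists A : R, forall x, `|p x| <= A.
Proof.
elim=> [k|p1 p2 _ [A1 h1] _ [A2 h2]|a p1 _ [A h]].
- by exists 2; exact: cas_le2.
- by exists (A1 + A2) => x; rewrite (le_trans (ler_normD _ _))// lerD.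
- by exists (`|a| * A) => x; rewrite normrM ler_wpM2l.
Qed.

Lemma integrableM_bounded r p (A : R) : mu.-integrable D (EFin \o r) ->
  measurable_fun D p -> (forall x, D x -> `|p x| <= A) ->
  mu.-integrable D (EFin \o (fun x => r x * p x)).
Proof.
move=> ir mp pA; have mr : measurable_fun D r.
  by move/measurable_int : ir => /measurable_EFinP; exact.
apply: (@le_integrable_domain _ (fun x => A * `|r x|)).
- exact: measurable_funM.
- by move=> x Dx; rewrite normrM mulrC ler_wpM2r// pA.
- by apply: integrable_domainZ; have := integrable_norm ir.
Qed.

Lemma Rintegral_trigpoly r p : mu.-integrable D (EFin \o r) ->
  (forall k, \int[mu]_(x in D) (r x * cas k x) = 0) -> trigpoly p ->
  \int[mu]_(x in D) (r x * p x) = 0.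
Proof.
move=> ir r0.
have it q : trigpoly q -> mu.-integrable D (EFin \o (fun x => r x * q x)).
  move=> tq; have [A hA] := trigpoly_bounded tq.
  by apply: (@integrableM_bounded _ _ A) => //; exact: measurable_trigpoly.
have mD := measurable_domain.
elim=> [//|p1 p2 t1 h1 t2 h2|a p1 t1 h1].
- rewrite (@eq_Rintegral _ _ _ mu D (fun x => r x * p1 x + r x * p2 x)).
    by rewrite RintegralD ?h1 ?h2 ?addr0//; exact: it.
  by move=> x _; rewrite mulrDr.
- rewrite (@eq_Rintegral _ _ _ mu D (fun x => a * (r x * p1 x))).
    by rewrite RintegralZl ?h1 ?mulr0//; exact: it.
  by move=> x _; rewrite mulrCA.
Qed.

(** * Approximation of indicators of initial segments *)

Lemma bernoulli_ge (x : R) n : -1 <= x -> 1 + n%:R * x <= (1 + x) ^+ n.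
Proof.
move=> x1; elim: n => [|n IH]; first by rewrite mul0r addr0 expr0.
have n0 : 0 <= n%:R :> R by [].
rewrite exprS -addn1 natrD.
apply: (@le_trans _ _ ((1 + x) * (1 + n%:R * x))); first by nra.
by rewrite ler_wpM2l//; lra.
Qed.

(* For 0 <= y <= 1, the Brosowski-Deutsch powers (1 - y^n)^(2^n) lie within
   (2y)^n of 1 and below (2y)^(-n). *)
Lemma cvg_brosowski_lt (y : R) : 0 <= y -> y < 2^-1 ->
  (fun n => (1 - y ^+ n) ^+ (2 ^ n)) @ \oo --> (1 : R).
Proof.
move=> y0 y2.
have yn n : 0 <= y ^+ n <= 1 by rewrite exprn_ge0//= exprn_ile1//; lra.
apply: (@squeeze_cvgr _ _ _ _ (fun n => 1 - (2 * y) ^+ n) (fun=> 1)).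
- apply: nearW => n; have /andP[y1 y3] := yn n; apply/andP; split.
    have := @bernoulli_ge (- y ^+ n) (2 ^ n) ltac:(lra).
    by rewrite mulrN natrX -exprMn.
  by rewrite exprn_ile1//; lra.
- rewrite -[X in _ --> X](subr0 1); apply: cvgB; first exact: cvg_cst.
  by apply: cvg_expr; rewrite ger0_norm; lra.
- exact: cvg_cst.
Qed.

Lemma cvg_brosowski_gt (y : R) : 2^-1 < y -> y <= 1 ->
  (fun n => (1 - y ^+ n) ^+ (2 ^ n)) @ \oo --> (0 : R).
Proof.
move=> y2 y1.
have yn n : 0 <= y ^+ n <= 1 by rewrite exprn_ge0 ?exprn_ile1//=; lra.
apply: (@squeeze_cvgr _ _ _ _ (fun=> 0) (fun n => ((2 * y)^-1) ^+ n)).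
- apply: nearW => n; have /andP[z0 z1] := yn n; apply/andP; split.
    by rewrite exprn_ge0//; lra.
  have y2n : 0 < (2 * y) ^+ n by rewrite exprn_gt0//; lra.
  rewrite exprVn -[leRHS]mul1r ler_pdivlMr//.
  have h := @bernoulli_ge (y ^+ n) (2 ^ n) ltac:(lra).
  rewrite natrX -exprMn in h.
  have q0 : 0 <= (1 - y ^+ n) ^+ (2 ^ n) by rewrite exprn_ge0//; lra.
  (* Bernoulli bounds (2y)^n by (1 + y^n)^(2^n), and the product of the two powers is (1 -
     y^(2n))^(2^n), at most 1. *)
  apply: (@le_trans _ _ ((1 - y ^+ n) ^+ (2 ^ n) * (1 + y ^+ n) ^+ (2 ^ n))).
    by rewrite ler_wpM2l//; lra.
  by rewrite -exprMn exprn_ile1//; nra.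
- exact: cvg_cst.
- by apply: cvg_expr; rewrite ger0_norm ?invr_ge0 ?invf_lt1; lra.
Qed.

Lemma ae_neq (b : R) : {ae mu, forall x, x != b}.
Proof.
exists [set b]; split=> [||x /=].
- exact: measurable_set1.
- exact: lebesgue_measure_set1.
- by move/negP; rewrite negbK => /eqP.
Qed.

(* As a function of x this is positive on ]-M pi, b[ and negative on ]b, M pi[,
   for b in D. *)
Definition sin_switch (b x : R) : R :=
  sin ((x / M + pi) / 2) * sin ((b / M - x / M) / 2).

(** The two half angles A and B have a constant sum, and A - B is x/M plus a constant, so sin A sin
    B = (cos (A - B) - cos (A + B)) / 2 has degree one although each factor has half-integer
    frequency. *)
Lemma trigpoly_sin_switch b : trigpoly (sin_switch b).
Proof.
pose d := (pi - b / M) / 2.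
apply: (@trigpoly_eq (fun x => 2^-1 * (cos d * (2^-1 * (cas 1 x + cas (-1) x)) +
  (- sin d) * (2^-1 * (cas 1 x + (-1) * cas (-1) x)) + (- cos ((pi + b / M) / 2))))).
  apply: trigpolyZ; apply: trigpolyD; last exact: trigpoly_cst.
  apply: trigpolyD; apply: trigpolyZ; apply: trigpolyZ; apply: trigpolyD;
    do ?apply: trigpolyZ; exact: trigpoly_cas.
move=> x; have ec := cos_cas 1 x; have es := sin_cas 1 x.
rewrite mul1r in ec es.
rewrite (_ : 2^-1 * (cas 1 x + cas (-1) x) = cos (x / M)); last by rewrite ec; ring.
rewrite (_ : 2^-1 * (cas 1 x + _) = sin (x / M)); last by rewrite es; ring.
rewrite /sin_switch; set A := (x / M + pi) / 2; set B := (b / M - x / M) / 2.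
have -> : (pi + b / M) / 2 = A + B by rewrite /A /B; ring.
have -> : d = (A - B) - x / M by rewrite /A /B /d; field; rewrite gt_eqF.
have c1 : cos (A - B - x / M) * cos (x / M) - sin (A - B - x / M) * sin (x / M) =
    cos (A - B) by rewrite -cosD; congr cos; ring.
by rewrite mulNr c1 cosB cosD; field.
Qed.

Lemma sin_switch_le1 b x : `|sin_switch b x| <= 1.
Proof.
rewrite /sin_switch normrM -[leRHS]mulr1.
by rewrite ler_pM ?normr_ge0 ?sin_max.
Qed.

Lemma sin_switch_gt0 b x : D b -> - (M * pi) < x -> x < b -> 0 < sin_switch b x.
Proof.
rewrite /domain /= in_itv/= => /andP[b1 b2] x1 x2.
have pi0 := @pi_gt0 R.
have xM : - pi < x / M by rewrite ltr_pdivlMr//; lra.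
have bM : b / M <= pi by rewrite ler_pdivrMr//; lra.
have xb : x / M < b / M by rewrite ltr_pM2r// invr_gt0.
by apply: mulr_gt0; apply: sin_gt0_pi; apply/andP; split; lra.
Qed.

Lemma sin_switch_lt0 b x : D b -> x < M * pi -> b < x -> sin_switch b x < 0.
Proof.
rewrite /domain /= in_itv/= => /andP[b1 b2] x1 x2.
have pi0 := @pi_gt0 R.
have xM : x / M < pi by rewrite ltr_pdivrMr//; lra.
have bM : - pi <= b / M by rewrite ler_pdivlMr//; lra.
have xb : b / M < x / M by rewrite ltr_pM2r// invr_gt0.
rewrite /sin_switch pmulr_rlt0.
  rewrite (_ : (b / M - x / M) / 2 = - ((x / M - b / M) / 2)); last by ring.
  by rewrite sinN oppr_lt0; apply: sin_gt0_pi; apply/andP; split; lra.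
by apply: sin_gt0_pi; apply/andP; split; lra.
Qed.

(** With p = (1 - [sin_switch b]) / 2, below 1/2 to the left of b and above it to the right, the
    Brosowski-Deutsch powers of p are trigonometric polynomials bounded by 1 that tend to the
    indicator almost everywhere. Each integrates to 0 against r, and |r| dominates. *)
Lemma Rintegral_initial_segment r b : mu.-integrable D (EFin \o r) ->
  (forall k, \int[mu]_(x in D) (r x * cas k x) = 0) -> D b ->
  \int[mu]_(x in D) ((r \_ `]-oo, b]) x) = 0.
Proof.
move=> ir r0 Db.
pose p x := 2^-1 * (1 + (-1) * sin_switch b x).
pose q n x := (1 + (-1) * p x ^+ n) ^+ (2 ^ n).
have p01 x : 0 <= p x <= 1.
  by have := sin_switch_le1 b x; rewrite ler_norml /p => /andP[? ?]; apply/andP; split; lra.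
have tq n : trigpoly (q n).
  apply: trigpolyX; apply: trigpolyD; first exact: trigpoly_cst.
  apply: trigpolyZ; apply: trigpolyX; apply: trigpolyZ; apply: trigpolyD.
    exact: trigpoly_cst.
  by apply: trigpolyZ; exact: trigpoly_sin_switch.
have q1 n x : `|q n x| <= 1.
  have /andP[p0 p1] := p01 x.
  have /andP[pn0 pn1] : 0 <= p x ^+ n <= 1 by rewrite exprn_ge0 ?exprn_ile1.
  by rewrite normrX exprn_ile1// ger0_norm; lra.
have mr : measurable_fun D r by move/measurable_int : (ir) => /measurable_EFinP; exact.
have [] := @dominated_Rintegral (fun n x => r x * q n x) (r \_ `]-oo, b])
  (fun x => `|r x|).
- by move=> n; apply: measurable_funM => //; exact: measurable_trigpoly.
- apply/measurable_restrict; [exact: measurable_itv|exact: measurable_domain|].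
  apply: measurable_funS mr => //; exact: measurable_domain.
(* At these three points the switch vanishes and p = 1/2, where neither limit lemma applies. *)
- have := ae_neq b; have := ae_neq (M * pi); have := ae_neq (- (M * pi)).
  apply: filterS3; first exact: (ae_filter_ringOfSetsType mu).
  move=> x xl xr xb Dx; move: (Dx); rewrite /domain/= in_itv/= => /andP[x1 x2].
  have /andP[p0 p1] := p01 x.
  have {}x1 : - (M * pi) < x by rewrite lt_neqAle eq_sym xl.
  have {}x2 : x < M * pi by rewrite lt_neqAle xr.
  rewrite patchE; case: ifPn => [/set_mem|/negP xnb].
    rewrite /= in_itv/= le_eqVlt (negbTE xb)/= => {}xb.
    rewrite -[X in _ --> X]mulr1; apply: cvgM; first exact: cvg_cst.
    under eq_fun do rewrite /q mulN1r.
    apply: cvg_brosowski_lt => //.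
    by have := sin_switch_gt0 Db x1 xb; rewrite /p; lra.
  rewrite -[X in _ --> X](mulr0 (r x)); apply: cvgM; first exact: cvg_cst.
  under eq_fun do rewrite /q mulN1r.
  apply: cvg_brosowski_gt => //.
  have {}xb : b < x.
    by rewrite ltNge; apply/negP => xb'; apply: xnb; rewrite inE/= in_itv.
  by have := sin_switch_lt0 Db x2 xb; rewrite /p; lra.
- by have := integrable_norm ir.
- by move=> n x _; rewrite normrM -[leRHS]mulr1 ler_wpM2l.
move=> _.
under eq_fun do rewrite Rintegral_trigpoly//.
by move/cvg_lim; rewrite lim_cst// => ->.
Qed.

(** The primitive of r, extended by zero, vanishes identically: trivially left of [D], by the
    previous lemma at points of [D], and by the coefficient of [cas 0] = 1 to the right of [D].
    Lebesgue differentiation then recovers r almost everywhere. *)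
Lemma ae_eq0_of_coef0 r : mu.-integrable D (EFin \o r) ->
  (forall k, \int[mu]_(x in D) (r x * cas k x) = 0) -> ae_eq mu D r (cst 0).
Proof.
move=> ir r0; have mD := measurable_domain.
have irD : mu.-integrable setT (EFin \o (r \_ D)).
  by rewrite -restrict_EFin; apply/integrable_restrict => //; rewrite setTI.
have F0 b : \int[mu]_(x in `]-oo, b]) ((r \_ D) x) = 0.
  rewrite -Rintegral_mkcondr setIC Rintegral_mkcondr.
  have [b1|b1] := ltP b (- (M * pi)).
    rewrite (@eq_Rintegral _ _ _ mu D (cst 0)).
      by rewrite Rintegral_cst ?mul0r.
    move=> x /set_mem; rewrite /domain/= in_itv/= => /andP[x1 x2].
    rewrite patchE ifF//; apply/negbTE/negP => /set_mem; rewrite /= in_itv/=.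
    by lra.
  have [b2|b2] := leP b (M * pi).
    by apply: Rintegral_initial_segment => //; rewrite /domain/= in_itv/= b1.
  rewrite (@eq_Rintegral _ _ _ mu D (fun x => r x * cas 0 x))//.
  move=> x /set_mem; rewrite /domain/= in_itv/= => /andP[x1 x2].
  by rewrite patchE cas0 mulr1 ifT//; apply/mem_set; rewrite /= in_itv/=; lra.
have iDy y : mu.-integrable `]-oo, y] (EFin \o (r \_ D)).
  by apply: integrableS irD => //; exact: measurable_itv.
have := FTC1Ny iDy (integrable_locally mD ir).
rewrite (_ : (fun x => _) = cst 0); last by apply/funext => b; exact: F0.
apply: filterS; first exact: (ae_filter_ringOfSetsType mu).
by move=> x [_]; rewrite derive1_cst patchE => + Dx; rewrite ifT// ?inE.
Qed.

(** * Sobolev weights, absolute convergence and Parseval's inequality *)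

Definition weight k : R := 1 + (k%:~R / M) ^+ 2.

Lemma weight_ge1 k : 1 <= weight k.
Proof. by rewrite lerDl sqr_ge0. Qed.

Lemma weightN k : weight (- k) = weight k.
Proof. by rewrite /weight mulrNz mulNr sqrrN. Qed.

Lemma sumZ_inv_weight n : sumZ n (fun k => (weight k)^-1) <= 1 + 4 * M ^+ 2.
Proof.
have M2 : 0 < M ^+ 2 by rewrite exprn_gt0.
(* Telescoping strengthening: 1/m^2 <= 2 (1/m - 1/(m+1)), counted once for m and once for -m, which
   explains the 4. *)
suff : sumZ n (fun k => (weight k)^-1) <= 1 + 4 * M ^+ 2 * (1 - (n.+1%:R)^-1).
  move=> /le_trans; apply; rewrite lerD2l ler_piMr ?gerBl ?invr_ge0//; lra.
elim: n => [|n IH].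
  by rewrite sumZ0 /weight mul0r expr0n/= addr0 !invr1 subrr mulr0 addr0.
rewrite sumZS weightN.
have n0 : 0 < n.+1%:R :> R by [].
have w : (weight n.+1%:Z)^-1 <= M ^+ 2 / n.+1%:R ^+ 2.
  rewrite -[leRHS]invf_div lef_pV2 ?posrE ?divr_gt0 ?exprn_gt0//.
    by rewrite /weight expr_div_n lerDr.
  by rewrite (lt_le_trans _ (weight_ge1 _)).
have e : (n.+2%:R : R) = n.+1%:R + 1 by rewrite -addn1 natrD.
have key (m : R) : 0 < m -> 2 * (m^-1 - (m + 1)^-1) = 2 / (m * (m + 1)).
  by move=> m0; field; rewrite !gt_eqF//; lra.
have t : (n.+1%:R ^+ 2)^-1 <= 2 * ((n.+1%:R)^-1 - (n.+2%:R)^-1) :> R.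
  rewrite (_ : 2 * _ = 2 / (n.+1%:R * n.+2%:R)); last first.
    by rewrite e key.
  have n1 : 1 <= n.+1%:R :> R by rewrite ler1n.
  by rewrite ler_pdivlMr ?mulr_gt0// mulrC ler_pdivrMr ?exprn_gt0// e; nra.
have : M ^+ 2 / n.+1%:R ^+ 2 <= M ^+ 2 * (2 * ((n.+1%:R)^-1 - (n.+2%:R)^-1)).
  by rewrite ler_pM2l.
move: IH w; set i1 := n.+1%:R^-1; set i2 := n.+2%:R^-1.
set w1 := (weight _)^-1; set z := M ^+ 2 / _; set S := sumZ _ _.
move: i1 i2 w1 z S => i1 i2 w1 z S; nra.
Qed.

(** Termwise |c| <= w c^2 + 1/w. This additive form replaces Cauchy-Schwarz in showing that H^1
    coefficients are absolutely summable. *)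
Lemma sumZ_norm_le (c : int -> R) (A : R) n :
  sumZ n (fun k => weight k * c k ^+ 2) <= A ->
  sumZ n (fun k => `|c k|) <= A + (1 + 4 * M ^+ 2).
Proof.
move=> cA; apply: le_trans (lerD cA (sumZ_inv_weight n)); rewrite -sumZD.
apply: le_sumZ => k; have w1 := weight_ge1 k; have w0 : 0 < weight k by lra.
rewrite -(ler_pM2l w0) mulrDr mulfV ?gt_eqF// mulrA -expr2 -exprMn.
rewrite -[X in X * `|_|](ger0_norm (ltW w0)) -normrM.
rewrite -(real_normK (num_real (_ * c k))); nra.
Qed.

Lemma cvg_sumZ (F : int -> R) (A : R) :
  (forall n, sumZ n (fun k => `|F k|) <= A) -> cvgn (fun n => sumZ n F).
Proof.
move=> FA.
(* Pairing m with -m gives an ordinary series; its partial sum over indices below n + 1 is the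
   symmetric sum up to n. *)
pose t (m : nat) := if m is m'.+1 then F (- m%:Z) + F m%:Z else F 0.
have tE n : sumZ n F = series t n.+1.
  elim: n => [|n IH]; first by rewrite sumZ0 /series/= big_nat1.
  by rewrite sumZS IH /series/= [RHS]big_nat_recr//=; ring.
have tN n : [series `|t m|]_m n.+1 <= sumZ n (fun k => `|F k|).
  elim: n => [|n IH]; first by rewrite sumZ0 /series/= big_nat1.
  rewrite sumZS /series/= big_nat_recr//=.
  have := ler_normD (F (- n.+1%:Z)) (F n.+1%:Z).
  by move: IH; rewrite /series/=; lra.
have ct : cvgn (series t).
  apply: normed_cvg; apply: nondecreasing_is_cvgn.
    by apply: nondecreasing_series => i _ _ /=; exact: normr_ge0.
  exists A => _ [[|n] _ <-].
    apply: (@le_trans _ _ 0); last by apply: le_trans (FA 0%N); rewrite sumZ0.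
    have t0 : [series `|t m|]_m 0%N = 0 by rewrite /series/= big_geq.
    by rewrite le_eqVlt; apply/orP; left; apply/eqP; exact: t0.
  exact: le_trans (tN n) (FA n).
rewrite (_ : (fun n => _) = (fun n => series t n.+1)); last by apply/funext.
by apply/cvg_ex; case/cvg_ex : ct => l tl; exists l; rewrite (cvg_shiftS (series t)).
Qed.

Lemma norm_cas_sum_le (c : int -> R) (A : R) n x :
  sumZ n (fun k => `|c k|) <= A -> `|cas_sum n c x| <= 2 * A.
Proof.
move=> cA; apply: (@le_trans _ _ (2 * sumZ n (fun k => `|c k|))); last by lra.
rewrite -sumZZ (le_trans (ler_norm_sum _ _ _))//; apply: ler_sum => i _.
by rewrite normrM mulrC ler_wpM2r ?cas_le2.
Qed.

(* The Fourier series converges uniformly; its sum has the coefficients of f,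
   hence equals f almost everywhere. *)
Lemma parseval_le f (A B : R) : sqint f ->
  (forall n, sumZ n (fun k => weight k * hcoef f k ^+ 2) <= A) ->
  (forall n, per * sumZ n (fun k => hcoef f k ^+ 2) <= B) ->
  \int[mu]_(x in D) (f x ^+ 2) <= B.
Proof.
move=> sf fA fB; set c := hcoef f; pose S n := cas_sum n c.
pose A1 := A + (1 + 4 * M ^+ 2).
(* The bound [A] serves qualitatively, to make the coefficients summable; the size of the final
   estimate comes from [B]. *)
have cA n : sumZ n (fun k => `|c k|) <= A1 by exact: sumZ_norm_le.
have SA n x : `|S n x| <= 2 * A1 by exact: norm_cas_sum_le.
have Scvg x : cvgn (S ^~ x).
  apply: (@cvg_sumZ _ (2 * A1)) => n.
  apply: (@le_trans _ _ (2 * sumZ n (fun k => `|c k|))).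
    rewrite -sumZZ; apply: le_sumZ => k.
    by rewrite normrM mulrC ler_wpM2r ?cas_le2.
  by have := cA n; lra.
pose g x := limn (S ^~ x).
have Sg x : S ^~ x @ \oo --> g x by exact: Scvg.
have mS n : measurable_fun D (S n) by case: (sqint_cas_sum n c).
have mg : measurable_fun D g.
  by apply: (measurable_fun_cvg mS) => x _; exact: Sg.
have gA x : `|g x| <= 2 * A1.
  have h : `|S n x| @[n --> \oo] --> `|g x| by apply: cvg_norm; exact: Sg.
  rewrite -(cvg_lim (@Rhausdorff R) h).
  apply: limr_le; first by apply/cvg_ex; exists `|g x|.
  exact: nearW.
have sg : sqint g by apply: (bounded_sqint mg) => x _; exact: gA.
have sfg := sqintB sf sg.
have gc k : hcoef g k = c k.
  have [|||||_ h] := @dominated_Rintegral (fun n x => S n x * cas k x)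
    (fun x => g x * cas k x) (fun=> 2 * A1 * 2).
  - by move=> n; apply: measurable_funM; [exact: mS|exact: measurable_cas].
  - by apply: measurable_funM => //; exact: measurable_cas.
  - by apply/aeW => x _; apply: cvgM; [exact: Sg|exact: cvg_cst].
  - exact: integrable_cst.
  - by move=> n x _; rewrite normrM ler_pM ?normr_ge0 ?cas_le2.
  (* This sequence is constant as soon as n >= |k|. *)
  have h2 : (fun n => \int[mu]_(x in D) (S n x * cas k x)) @ \oo --> per * c k.
    apply: cvg_near_cst; exists `|k|%N => // n /= kn.
    by rewrite -per_hcoef hcoef_cas_sum ifT.
  have : per * hcoef g k = per * c k.
    by rewrite per_hcoef; exact: (cvg_unique _ h h2).
  by move/(mulfI _); apply; rewrite gt_eqF// per_gt0.
have fg0 : ae_eq mu D (fun x => f x - g x) (cst 0).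
  apply: ae_eq0_of_coef0 => [|k]; first exact: sqint_integrable.
  by rewrite -per_hcoef hcoefB// gc subrr mulr0.
have -> : \int[mu]_(x in D) (f x ^+ 2) = \int[mu]_(x in D) (g x ^+ 2).
  apply: ae_eq_Rintegral.
  - by apply: measurable_funX; case: sf.
  - exact: measurable_funX.
  - apply: filterS fg0 => x /= fg Dx.
    by have /eqP := fg Dx; rewrite subr_eq0 => /eqP ->.
have [|||||_ h] := @dominated_Rintegral (fun n x => S n x ^+ 2)
    (fun x => g x ^+ 2) (fun=> (2 * A1) ^+ 2).
- by move=> n; apply: measurable_funX; exact: mS.
- exact: measurable_funX.
- by apply/aeW => x _; apply: cvgM; exact: Sg.
- exact: integrable_cst.
- move=> n x _; rewrite normrX lerXn2r ?nnegrE//.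
  by rewrite (le_trans _ (SA n x)).
rewrite -(cvg_lim _ h)//; apply: limr_le; first by apply/cvg_ex; eexists; exact: h.
by apply: nearW => n; rewrite Rintegral_cas_sum_sqr.
Qed.

(** * Sobolev norms and projections in terms of Hartley coefficients *)

Lemma sumZ_seq n : exists2 r : seq int,
  uniq r /\ [set k : int | (`|k| <= n)%N] = [set` r] &
  forall F, sumZ n F = \sum_(k <- r) F k.
Proof.
pose r := [seq (val j)%:Z - n%:Z | j <- enum 'I_(2 * n).+1].
exists r; last by move=> F; rewrite /r big_map big_enum.
split.
  rewrite map_inj_uniq ?enum_uniq// => i j ij; apply/val_inj.
  by move: ij => /= ij; lia.
apply/seteqP; split=> k /=.
  move=> kn; apply/mapP; have kl : (`|(k + n%:Z)%R|%N < (2 * n).+1)%N by lia.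
  by exists (Ordinal kl); rewrite ?mem_enum//=; lia.
by move=> /mapP[j _ -> /=]; have := ltn_ord j; lia.
Qed.

(** Every finite set of integers lies in a symmetric window, so the unordered sum can be bounded
    through [sumZ] without being evaluated. *)
Lemma esum_int_le (a : int -> R) (B : R) : (forall k, 0 <= a k) ->
  (\esum_(k in [set: int]) (a k)%:E <= B%:E)%E <-> forall n, sumZ n a <= B.
Proof.
move=> a0.
have fin n : finite_set [set k : int | (`|k| <= n)%N].
  by have [r [_ ->] _] := sumZ_seq n; exact: finite_seq.
have E n : (sumZ n a)%:E = (\sum_(k \in [set k : int | (`|k| <= n)%N]) (a k)%:E)%E.
  by rewrite fsumEFin//; have [r [ur ->] ->] := sumZ_seq n; rewrite -fsbig_seq.
split=> [h n|h].
  rewrite -lee_fin; apply: le_trans h; rewrite E; apply: esum_ge.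
  by eexists; last exact: lexx.
apply: ub_ereal_sup => _ [A [finA _] <-].
have [n An] : exists n, forall k, A k -> (`|k| <= n)%N.
  have /finite_seqP[r ->] := finA.
  exists (\max_(k <- r) `|k|%N)%N => k /= kr.
  by rewrite (big_rem k)//= leq_max leqnn.
apply: (@le_trans _ _ (sumZ n a)%:E); last by rewrite lee_fin.
rewrite E; apply: lee_fsum_nneg_subset => //.
  by move=> k /set_mem Ak; apply/mem_set/An.
by move=> k _; rewrite lee_fin.
Qed.

Lemma sumZN n F : sumZ n (fun k => F (- k)) = sumZ n F.
Proof.
elim: n => [|n IH]; first by rewrite !sumZ0 oppr0.
by rewrite !sumZS IH opprK addrAC [RHS]addrC addrA.
Qed.

Lemma re_coef f k : sqint f ->
  per^-1 * \int[mu]_(x in D) (f x * cos (k%:~R * x / M)) =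
  (hcoef f k + hcoef f (- k)) / 2.
Proof.
move=> sf; have mD := measurable_domain.
rewrite (@eq_Rintegral _ _ _ mu D (fun x => 2^-1 * (f x * cas k x) +
    2^-1 * (f x * cas (- k) x))); last by move=> x _; rewrite cos_cas; ring.
rewrite RintegralD//; do ?[by apply: integrable_domainZ; exact: integrable_cas].
rewrite !RintegralZl//; do ?exact: integrable_cas.
by rewrite /hcoef; ring.
Qed.

Lemma im_coef f k : sqint f ->
  per^-1 * \int[mu]_(x in D) (f x * sin (k%:~R * x / M)) =
  (hcoef f k - hcoef f (- k)) / 2.
Proof.
move=> sf; have mD := measurable_domain.
rewrite (@eq_Rintegral _ _ _ mu D (fun x => 2^-1 * (f x * cas k x) +
    (- 2^-1) * (f x * cas (- k) x))); last by move=> x _; rewrite sin_cas; ring.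
rewrite RintegralD//; do ?[by apply: integrable_domainZ; exact: integrable_cas].
rewrite !RintegralZl//; do ?exact: integrable_cas.
by rewrite /hcoef; ring.
Qed.

(** Up to sign, real and imaginary parts are the even and odd parts of [hcoef f] in k; the
    parallelogram identity adds their squares. *)
Lemma normc_fourier_coef f k : sqint f ->
  ComplexField.Normc.normc (fourier_coef M f k) ^+ 2 =
  (hcoef f k ^+ 2 + hcoef f (- k) ^+ 2) / 2.
Proof.
move=> sf; rewrite /fourier_coef /cintegral /fourier_mode /=.
set I1 := Rintegral _ _ _; set I2 := Rintegral _ _ _.
have e1 : per^-1 * I1 = (hcoef f k + hcoef f (- k)) / 2.
  rewrite -re_coef//; congr (_ * _); apply: eq_Rintegral => x _.
  by rewrite mul0r subr0 mulrNz !mulNr cosN.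
have e2 : per^-1 * I2 = - ((hcoef f k - hcoef f (- k)) / 2).
  rewrite -mulNr opprB -[X in _ = (_ - hcoef f X) / 2]opprK -im_coef//.
  by congr (_ * _); apply: eq_Rintegral => x _; rewrite mul0r addr0.
rewrite sqr_sqrtr; last by rewrite addr_ge0 ?sqr_ge0.
by rewrite !mul0r subr0 addr0 e1 e2; field.
Qed.

Lemma Hnorm_sqr s f : (Hnorm M s f `^ 2 =
  \esum_(k in [set: int]) (per * weight k `^ s *
    ComplexField.Normc.normc (fourier_coef M f k) ^+ 2)%:E)%E.
Proof.
rewrite /Hnorm -poweRrM mulVf// poweRe1//.
apply: esum_ge0 => k _; rewrite lee_fin mulr_ge0 ?sqr_ge0//.
by rewrite mulr_ge0 ?powR_ge0// ltW// per_gt0.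
Qed.

(** Averaging over k and -k disappears under a symmetric sum with even weights. Two functions are
    treated together because [Xnorm] takes the supremum of a sum of two squared norms. *)
Lemma Hnorm_sqrD_le s f g (B : R) : sqint f -> sqint g ->
  (Hnorm M s f `^ 2 + Hnorm M s g `^ 2 <= B%:E)%E <->
  forall n, per * sumZ n (fun k => weight k `^ s * (hcoef f k ^+ 2 + hcoef g k ^+ 2)) <= B.
Proof.
move=> sf sg.
have -> : (Hnorm M s f `^ 2 + Hnorm M s g `^ 2 =
    \esum_(k in [set: int]) (per * weight k `^ s *
      ComplexField.Normc.normc (fourier_coef M f k) ^+ 2)%:E +
    \esum_(k in [set: int]) (per * weight k `^ s *
      ComplexField.Normc.normc (fourier_coef M g k) ^+ 2)%:E)%E.
  by congr (_ + _)%E; exact: Hnorm_sqr.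
have per0 := per_gt0.
have c0 h k : 0 <= per * weight k `^ s *
    ComplexField.Normc.normc (fourier_coef M h k) ^+ 2.
  by rewrite mulr_ge0 ?sqr_ge0// mulr_ge0 ?powR_ge0// ltW.
rewrite -esumD; [|by move=> k _; rewrite lee_fin|by move=> k _; rewrite lee_fin].
under eq_esum do rewrite -EFinD -mulrDr.
rewrite esum_int_le => [|k]; last by rewrite mulrDr addr_ge0.
pose H k := weight k `^ s * (hcoef f k ^+ 2 + hcoef g k ^+ 2).
have e n : sumZ n (fun k => per * weight k `^ s *
    (ComplexField.Normc.normc (fourier_coef M f k) ^+ 2 +
     ComplexField.Normc.normc (fourier_coef M g k) ^+ 2)) = per * sumZ n H.
  rewrite -sumZZ (@eq_sumZ n _ (fun k => 2^-1 * (per * H k) + 2^-1 * (per * H (- k)))).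
    by rewrite sumZD !sumZZ (sumZN n H); field.
  by move=> k; rewrite !normc_fourier_coef// /H weightN; field.
by split=> h n; [rewrite -e|rewrite e].
Qed.

(** * Complex trigonometric polynomials and the projection *)

Lemma re_mul_mode (c : R[i]) k x :
  complex.Re (c * fourier_mode M k x) =
  complex.Re c * ((cas k x + cas (- k) x) / 2) -
  complex.Im c * ((cas k x - cas (- k) x) / 2).
Proof. by rewrite -cos_cas -sin_cas; case: c. Qed.

Lemma im_mul_mode (c : R[i]) k x :
  complex.Im (c * fourier_mode M k x) =
  complex.Re c * ((cas k x - cas (- k) x) / 2) +
  complex.Im c * ((cas k x + cas (- k) x) / 2).
Proof. by rewrite -cos_cas -sin_cas; case: c. Qed.

Lemma complex_sum (I : Type) (r : seq I) (F : I -> R[i]) :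
  \sum_(i <- r) F i = ((\sum_(i <- r) complex.Re (F i)) +i* (\sum_(i <- r) complex.Im (F i)))%C.
Proof.
elim: r => [|i r IH]; first by rewrite !big_nil.
by rewrite !big_cons IH; case: (F i).
Qed.

Lemma sumZ_cas_reflect n (a b : int -> R) x :
  sumZ n (fun k => a k * cas k x + b k * cas (- k) x) =
  cas_sum n (fun k => a k + b (- k)) x.
Proof.
rewrite sumZD -(sumZN n (fun k => b k * _)) -sumZD.
by apply: eq_sumZ => k; rewrite opprK mulrDl.
Qed.

Lemma trig_space_cas N (phi : R -> R[i]) : trig_space M N phi ->
  exists c d : int -> R, forall x, D x -> phi x = (cas_sum N c x +i* cas_sum N d x)%C.
Proof.
move=> [c cE].
(* Reindexes [c] by frequency; the values outside the window |k| <= N are arbitrary and never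
   reached. *)
pose C k : R[i] := c (inord `|(k + N%:Z)%R|%N).
pose A k := complex.Re (C k); pose B k := complex.Im (C k).
exists (fun k => (A k - B k) / 2 + (A (- k) + B (- k)) / 2),
       (fun k => (A k + B k) / 2 + (B (- k) - A (- k)) / 2) => x Dx.
rewrite cE// complex_sum.
rewrite -(sumZ_cas_reflect N (fun k => (A k - B k) / 2) (fun k => (A k + B k) / 2)).
rewrite -(sumZ_cas_reflect N (fun k => (A k + B k) / 2) (fun k => (B k - A k) / 2)).
have Cj (j : 'I_(2 * N).+1) : c j = C (j%:Z - N%:Z).
  by rewrite /C; congr c; apply/val_inj; rewrite /= inordK; have := ltn_ord j; lia.
congr (_ +i* _)%C; apply: eq_bigr => j _.
- by rewrite re_mul_mode Cj -/(A _) -/(B _); field.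
- by rewrite im_mul_mode Cj -/(A _) -/(B _); field.
Qed.

Lemma cas_sum_trig_space N (c : int -> R) : trig_space M N (fun x => (cas_sum N c x)%:C%C).
Proof.
(* These coefficients are conjugate at k and -k, so the imaginary parts of the sum cancel in
   pairs. *)
exists (fun j => let k := j%:Z - N%:Z in
  (((c k + c (- k)) / 2) +i* ((c (- k) - c k) / 2))%C) => x Dx.
rewrite complex_sum; congr (_ +i* _)%C.
  transitivity (cas_sum N (fun k => c k / 2 + c (- - k) / 2) x).
    by apply: eq_sumZ => k; rewrite opprK; congr (_ * _); field.
  rewrite -(sumZ_cas_reflect N (fun k => c k / 2) (fun k => c (- k) / 2)).
  by apply: eq_bigr => j _; rewrite re_mul_mode /=; field.
transitivity (cas_sum N (fun k => c (- k) / 2 + - c (- k) / 2) x).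
  rewrite -[LHS](mul0r (sumZ N (fun=> 0))) -sumZZ; apply: eq_sumZ => k.
  by rewrite mul0r; field.
rewrite -(sumZ_cas_reflect N (fun k => c (- k) / 2) (fun k => - c k / 2)).
by apply: eq_bigr => j _; rewrite im_mul_mode /=; field.
Qed.

Lemma in_S_cas_sum N f : in_S M N f ->
  exists c : int -> R, forall x, D x -> f x = cas_sum N c x.
Proof.
by move=> /trig_space_cas[c [d fE]]; exists c => x Dx; have [] := fE x Dx.
Qed.

Lemma sqint_in_S N f : in_S M N f -> sqint f.
Proof.
move=> /in_S_cas_sum[c fE].
by apply: eq_sqint (sqint_cas_sum N c) => x Dx; rewrite fE.
Qed.

Lemma hcoef_in_S N f k : in_S M N f -> (N < `|k|)%N -> hcoef f k = 0.
Proof.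
move=> /in_S_cas_sum[c fE] kN; rewrite (eq_hcoef k fE) hcoef_cas_sum ifF//.
by apply/negbTE; rewrite -ltnNge.
Qed.

(** [P_] is a choice with a default, so its defining property needs a witness: the truncated Hartley
    series. *)
Lemma P_spec N f : sqint f -> in_S M N (P_ M N f) /\
  forall phi, trig_space M N phi ->
    cintegral D (fun x => (f x - P_ M N f x)%:C%C * phi x) = 0.
Proof.
move=> sf; pose Q := [set p | in_S M N p /\ forall phi, trig_space M N phi ->
  cintegral D (fun x => (f x - p x)%:C%C * phi x) = 0].
suff : exists p, Q p by exact: (@xgetPex _ (fun=> 0) Q).
exists (cas_sum N (hcoef f)); split; first exact: cas_sum_trig_space.
move=> phi /trig_space_cas[c [d phiE]].
have sS : sqint (cas_sum N (hcoef f)) := sqint_cas_sum _ _.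
have ort (a : int -> R) :
    \int[mu]_(x in D) ((f x - cas_sum N (hcoef f) x) * cas_sum N a x) = 0.
  rewrite Rintegral_cas_sumM; last exact: sqintB.
  rewrite /sumZ big1 ?mulr0// => j _.
  rewrite hcoefB// hcoef_cas_sum ifT ?subrr ?mulr0//.
  by have := ltn_ord j; lia.
rewrite /cintegral -[RHS]/(0 +i* 0)%C; congr (_ +i* _)%C.
- rewrite -(ort c); apply: eq_Rintegral => x /set_mem Dx.
  by rewrite phiE//= mul0r subr0.
- rewrite -(ort d); apply: eq_Rintegral => x /set_mem Dx.
  by rewrite phiE//= mul0r addr0.
Qed.

Lemma in_S_P N f : sqint f -> in_S M N (P_ M N f).
Proof. by case/(@P_spec N). Qed.

Lemma hcoef_P N f k : sqint f ->
  hcoef (P_ M N f) k = if (`|k| <= N)%N then hcoef f k else 0.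
Proof.
move=> sf; have [pS pO] := P_spec N sf.
have sp := sqint_in_S pS.
case: ifPn => kN; last by rewrite (hcoef_in_S pS)// ltnNge.
(* Orthogonality is tested against the single mode [cas k]. *)
have := pO _ (cas_sum_trig_space N (fun l => (l == k)%:R)) => /(congr1 (@complex.Re R)) /=.
rewrite (@eq_Rintegral _ _ _ mu D (fun x => (f x - P_ M N f x) *
  cas_sum N (fun l => (l == k)%:R) x)); last by move=> x _ /=; rewrite mul0r subr0.
rewrite Rintegral_cas_sumM; last exact: sqintB.
rewrite (eq_sumZ N (fun l => mulrC _ _)) sumZ_delta kN hcoefB// => /eqP.
by rewrite mulf_eq0 gt_eqF ?per_gt0//= subr_eq0 => /eqP ->.
Qed.

(** * Time derivatives *)

(** Cauchy-Schwarz against [cas k], whose squared L^2 norm is [per]; this continuity lets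
    coefficients pass through L^2 limits in time. *)
Lemma hcoef_le f k : sqint f ->
  `|hcoef f k| <= per^-1 * Num.sqrt per * fine (L2norm M f).
Proof.
move=> sf; have per0 := per_gt0.
have cc : \int[mu]_(x in D) (cas k x ^+ 2) = per.
  rewrite (@eq_Rintegral _ _ _ mu D (fun x => cas k x * cas k x)) ?Rintegral_casM.
    by rewrite eqxx mulr1.
  by move=> x _; rewrite expr2.
have := cauchy_schwarz sf (sqint_cas k); rewrite cc => /(_ per0) h.
rewrite /hcoef normrM ger0_norm ?invr_ge0 ?(ltW per0)// -[leRHS]mulrA.
rewrite ler_wpM2l ?invr_ge0 ?(ltW per0)//.
rewrite L2normE//= -sqrtrM; last exact: ltW.
by rewrite -sqrtr_sqr ler_wsqrtr// mulrC.
Qed.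

(** Scalar counterpart of [is_time_derivative], along the same filter and hence one-sided at 0 and
    T. *)
Definition has_slope (T : R) (h : R -> R) (t l : R) : Prop :=
  (h tau - h t) / (tau - t) @[tau --> within `[0, T] t^'] --> l.

Lemma near_within (T t : R) (P : R -> Prop) :
  (forall tau, tau \in `[0, T] -> tau != t -> P tau) ->
  \forall tau \near within `[0, T] t^', P tau.
Proof.
move=> h; rewrite near_withinE; near=> tau => tauT.
apply: h; first by [].
by near: tau; exact: nbhs_dnbhs_neq.
Unshelve. all: by end_near. Qed.

Lemma sqint_diff_quotient f g (a : R) : sqint f -> sqint g ->
  sqint (fun x => (f x - g x) / a).
Proof.
move=> sf sg; apply: (@eq_sqint (fun x => a^-1 * (f x - g x))).
  by move=> x _; rewrite mulrC.
by apply: sqintZ; exact: sqintB.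
Qed.

Lemma hcoef_diff_quotient f g (a : R) k : sqint f -> sqint g ->
  hcoef (fun x => (f x - g x) / a) k = (hcoef f k - hcoef g k) / a.
Proof.
move=> sf sg; rewrite mulrC -hcoefB// -hcoefZ; last exact: sqintB.
by apply: eq_hcoef => x _; rewrite mulrC.
Qed.

Lemma hcoef_has_slope T u t (w : R -> R) k :
  (forall tau, tau \in `[0, T] -> sqint (u tau)) -> t \in `[0, T] -> sqint w ->
  is_time_derivative (L2norm M) T u t w ->
  has_slope T (fun tau => hcoef (u tau) k) t (hcoef w k).
Proof.
move=> su tT sw uw; have sut := su _ tT.
pose F tau x := (u tau x - u t x) / (tau - t) - w x.
have sF tau : tau \in `[0, T] -> sqint (F tau).
  by move=> /su suT; apply: sqintB => //; exact: sqint_diff_quotient.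
have F0 : fine (L2norm M (F tau)) @[tau --> within `[0, T] t^'] --> (0 : R).
  by apply: fine_cvg; exact: uw.
pose c0 := per^-1 * Num.sqrt per.
have c0F : c0 * fine (L2norm M (F tau)) @[tau --> within `[0, T] t^'] --> (0 : R).
  by rewrite -[X in _ --> X](mulr0 c0); apply: cvgM => //; exact: cvg_cst.
apply: (@squeeze_cvgr _ _ _ _ (fun tau => hcoef w k - c0 * fine (L2norm M (F tau)))
  (fun tau => hcoef w k + c0 * fine (L2norm M (F tau)))).
- apply: near_within => tau tauT _; have suT := su _ tauT.
  have := hcoef_le k (sF _ tauT); rewrite -/c0 ler_norml.
  rewrite [hcoef (F tau) k](_ : _ = (hcoef (u tau) k - hcoef (u t) k) / (tau - t) - hcoef w k).
    by move=> /andP[? ?]; apply/andP; split; lra.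
  rewrite -hcoef_diff_quotient// -hcoefB//; exact: sqint_diff_quotient.
- by rewrite -[X in _ --> X]subr0; apply: cvgB => //; exact: cvg_cst.
- by rewrite -[X in _ --> X]addr0; apply: cvgD => //; exact: cvg_cst.
Qed.

Lemma time_derivativeB T u v t (w z : R -> R) :
  (forall tau, tau \in `[0, T] -> sqint (u tau)) ->
  (forall tau, tau \in `[0, T] -> sqint (v tau)) ->
  t \in `[0, T] -> sqint w -> sqint z ->
  is_time_derivative (L2norm M) T u t w ->
  is_time_derivative (L2norm M) T v t z ->
  is_time_derivative (L2norm M) T (fun tau x => u tau x - v tau x) t
    (fun x => w x - z x).
Proof.
move=> su sv tT sw sz du dv; have sut := su _ tT; have svt := sv _ tT.
have s0 : (L2norm M (fun x => (u tau x - u t x) / (tau - t) - w x)%R +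
   L2norm M (fun x => (v tau x - v t x) / (tau - t) - z x)%R)%E
   @[tau --> within `[0, T] t^'] --> (0 : \bar R)%E.
  by rewrite -[X in _ --> X]adde0; apply: cvgeD; [|exact: du|exact: dv].
apply: squeeze_cvge (cvg_cst 0%E) s0.
apply: near_within => tau tauT _; apply/andP; split; first exact: Lnorm_ge0.
have suT := su _ tauT; have svT := sv _ tauT.
rewrite [X in L2norm M X](_ : _ = (fun x => ((u tau x - u t x) / (tau - t) - w x) -
  ((v tau x - v t x) / (tau - t) - z x))); last by apply/funext => x; ring.
by apply: L2normB; apply: sqintB => //; exact: sqint_diff_quotient.
Qed.

Lemma has_slope_cvg T h t l : has_slope T h t l ->
  h tau @[tau --> within `[0, T] (nbhs t)] --> h t.
Proof.
move=> hl.
have h0 : h tau @[tau --> within `[0, T] t^'] --> h t.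
  have : (h tau - h t) / (tau - t) * (tau - t) + h t
      @[tau --> within `[0, T] t^'] --> l * (t - t) + h t.
    apply: cvgD; last exact: cvg_cst.
    apply: cvgM; first exact: hl.
    apply: cvgB; last exact: cvg_cst.
    apply: cvg_trans (cvg_within _) _; exact: nbhs_dnbhs.
  rewrite subrr mulr0 add0r; apply: cvg_trans; apply: near_eq_cvg.
  apply: near_within => tau _ taut; rewrite divfK ?subrK// subr_eq0//.
move=> U hU; have hn : \forall tau \near t, tau != t -> tau \in `[0, T] -> U (h tau).
  exact: (h0 _ hU).
apply: filterS hn => tau hn tauT; have [->|taut] := eqVneq tau t.
  exact: nbhs_singleton hU.
exact: hn.
Qed.

Lemma has_slope_is_derive T h t l : 0 < t -> t < T -> has_slope T h t l ->
  is_derive t 1 h l.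
Proof.
move=> t0 tT hl.
have H : (fun s : R => s^-1 *: ((h \o shift t) (s *: 1) - h t)) @ 0^' --> l.
  apply/cvgrPdist_lt => e e0.
  have /cvgrPdist_lt/(_ e e0) := hl.
  rewrite near_withinE /dnbhs near_withinE => /nbhs_ballP[d /= d0 dh].
  apply/nbhs_ballP; exists (Num.min d (Num.min t (T - t))) => /=.
    by rewrite !lt_min d0 t0 subr_gt0 tT.
  move=> s; rewrite /ball/= sub0r normrN !lt_min => /and3P[sd st sT] s0.
  have := dh (s + t); rewrite /ball/= opprD addrCA subrr addr0 normrN => /(_ sd).
  rewrite addrK => dhs.
  rewrite /= /GRing.scale/= mulr1 [_^-1 * _]mulrC; apply: dhs.
    by rewrite -subr_eq0 addrK.
  move: st sT; rewrite !ltr_norml => /andP[? ?] /andP[? ?].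
  by rewrite /= in_itv/=; apply/andP; split; lra.
apply: DeriveDef; first by apply/cvg_ex; exists l.
exact: cvg_lim H.
Qed.

(** Uniqueness needs a proper filter, that is, points of [[0, T]] arbitrarily near t and distinct
    from it: they are found to the right if t < T, to the left otherwise. *)
Lemma has_slope_unique T h t l l' : 0 < T -> t \in `[0, T] ->
  has_slope T h t l -> has_slope T h t l' -> l = l'.
Proof.
move=> T0 tT.
have PF : ProperFilter (within `[0, T] t^').
  split; last exact: within_filter.
  rewrite /within /dnbhs /within/= => /nbhs_ballP[d /= d0 dh].
  move: tT; rewrite in_itv/= => /andP[t0 tT].
  have [tlt|tge] := ltP t T.
    pose e := Num.min (d / 2) (T - t).
    have e0 : 0 < e by rewrite lt_min divr_gt0//= subr_gt0.
    have ed : e <= d / 2 by rewrite ge_min lexx.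
    have eT : e <= T - t by rewrite ge_min lexx orbT.
    apply: (dh (t + e)).
    - by rewrite /ball/= opprD addrA subrr sub0r normrN gtr0_norm//; lra.
    - by rewrite -subr_eq0 addrAC subrr add0r gt_eqF.
    - by rewrite /= in_itv/=; apply/andP; split; lra.
  pose e := Num.min (d / 2) t.
  have tgt : 0 < t by lra.
  have e0 : 0 < e by rewrite lt_min divr_gt0//=.
  have ed : e <= d / 2 by rewrite ge_min lexx.
  have et : e <= t by rewrite ge_min lexx orbT.
  apply: (dh (t - e)).
  - by rewrite /ball/= opprB addrC subrK gtr0_norm//; lra.
  - by rewrite -subr_eq0 addrAC subrr add0r oppr_eq0 gt_eqF.
  - by rewrite /= in_itv/=; apply/andP; split; lra.
exact: cvg_unique.
Qed.

(** * Gronwall's inequality for the low-frequency energy *)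

Lemma gronwall_energy (T gamma kappa : R) n (w v a : int -> R -> R) :
  0 < T -> 0 <= gamma -> 0 <= kappa ->
  (forall k t, t \in `[0, T] -> has_slope T (w k) t (v k t)) ->
  (forall k t, t \in `[0, T] -> has_slope T (v k) t (a k t)) ->
  (forall k, (`|k| <= n)%N -> w k 0 = 0) ->
  (forall k, (`|k| <= n)%N -> v k 0 = 0) ->
  (forall t, t \in `[0, T] -> sumZ n (fun k => a k t ^+ 2) <=
     gamma * (sumZ n (fun k => w k t ^+ 2) + kappa)) ->
  forall t, t \in `[0, T] ->
  sumZ n (fun k => w k t ^+ 2 + v k t ^+ 2) <=
    gamma * kappa * T * expR ((2 + gamma) * T).
Proof.
move=> T0 g0 k0 dw dv w0 v0 aw.
(* From 2wv <= w^2 + v^2 and 2va <= v^2 + a^2 one gets E' <= 2E + (sum of a^2) <= c E + gamma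
   kappa. *)
pose c := 2 + gamma.
pose E t := sumZ n (fun k => w k t ^+ 2 + v k t ^+ 2).
pose E' t := sumZ n (fun k => 2 * w k t * v k t + 2 * v k t * a k t).
(* Nonincreasing: as exp(-ct) <= 1, the linear term absorbs the forcing gamma kappa. *)
pose phi t := expR (- c * t) * E t - gamma * kappa * t.
pose phi' t := expR (- c * t) * (E' t - c * E t) - gamma * kappa.
have dphi t : 0 < t -> t < T -> is_derive t 1 phi (phi' t).
  move=> t0 tT; have tI : t \in `[0, T] by rewrite in_itv/= !ltW.
  have dwk k := has_slope_is_derive t0 tT (dw k t tI).
  have dvk k := has_slope_is_derive t0 tT (dv k t tI).
  have dEk k : is_derive t 1 (fun t => w k t ^+ 2 + v k t ^+ 2)
      (2 * w k t * v k t + 2 * v k t * a k t).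
    apply: is_derive_eq; rewrite /GRing.scale/=; ring.
  have dE : is_derive t 1 E (E' t).
    have := @is_derive_sum _ _ _ (2 * n).+1
      (fun j t => w (j%:Z - n%:Z) t ^+ 2 + v (j%:Z - n%:Z) t ^+ 2) t 1 _
      (fun j => dEk (j%:Z - n%:Z)).
    by rewrite fct_sumE.
  have dexp : is_derive t 1 (fun t => expR (- c * t)) (expR (- c * t) * - c).
    apply: (is_derive1_comp (f := expR) (g := fun t => - c * t)).
    by apply: is_derive_eq; rewrite /GRing.scale/=; ring.
  rewrite /phi; apply: is_derive_eq; rewrite /phi' /GRing.scale/=; ring.
(* Slopes are one-sided at 0 and T, so monotonicity uses derivatives inside the interval and
   continuity up to its ends. *)
have cphi : {within `[0, T], continuous phi}.
  apply/subspace_continuousP => t tT.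
  have cw k := has_slope_cvg (dw k t tT).
  have cv k := has_slope_cvg (dv k t tT).
  have cid : tau @[tau --> within `[0, T] (nbhs t)] --> t by exact: cvg_within.
  apply: cvgB; last by apply: cvgM; [exact: cvg_cst|exact: cid].
  apply: cvgM.
    apply: (cvg_comp (fun tau => - c * tau) expR); last exact: continuous_expR.
    by apply: cvgM; [exact: cvg_cst|exact: cid].
  rewrite /E /sumZ; apply: cvg_big => [|j _]; first exact: add_continuous.
  by apply: cvgD; apply: cvgM; [exact: cw|exact: cw|exact: cv|exact: cv].
have phi'_le t : 0 < t -> t < T -> phi' t <= 0.
  move=> t0 tT; have tI : t \in `[0, T] by rewrite in_itv/= !ltW.
  have e1 : 0 <= expR (- c * t) <= 1.
    rewrite expR_ge0 -expR0 ler_expR /= mulNr oppr_le0 mulr_ge0//; last exact: ltW.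
    by rewrite /c addr_ge0.
  have h1 : E' t <= 2 * E t + sumZ n (fun k => a k t ^+ 2).
    rewrite /E -sumZZ -sumZD; apply: le_sumZ => k.
    have := sqr_ge0 (w k t - v k t); have := sqr_ge0 (v k t - a k t).
    by have := sqr_ge0 (w k t); rewrite !sqrrB; lra.
  have h2 : sumZ n (fun k => w k t ^+ 2) <= E t.
    by apply: le_sumZ => k; rewrite lerDl sqr_ge0.
  have h3 := aw _ tI.
  have h4 : E' t - c * E t <= gamma * kappa.
    have : gamma * sumZ n (fun k => w k t ^+ 2) <= gamma * E t by rewrite ler_wpM2l.
    by rewrite /c; lra.
  have gk : 0 <= gamma * kappa by rewrite mulr_ge0.
  by case/andP : e1 => e0 e1; rewrite /phi'; nra.
move=> t tT; move: (tT); rewrite in_itv/= => /andP[t0 tT'].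
have dphi' x : x \in `]0, T[ -> is_derive x 1 phi (phi' x).
  by rewrite in_itv/= => /andP[]; exact: dphi.
have h : phi t <= phi 0.
  have dd x : x \in `]0, T[ -> derivable phi x 1 by move=> /dphi'[].
  apply: (ler0_derive1_nincr dd _ cphi (lexx 0) t0 tT').
  move=> x xT; rewrite derive1E; have [_ ->] := dphi' _ xT.
  by move: xT; rewrite in_itv/= => /andP[]; exact: phi'_le.
move: h; rewrite /phi mulr0 expR0 mul1r.
rewrite [E 0](_ : _ = 0) ?mulr0 ?subr0; last first.
  by rewrite /E /sumZ big1// => j _; have jn := ltn_ord j; rewrite w0 ?v0 ?expr2 ?mulr0 ?addr0//; lia.
rewrite subr_le0 mulNr expRN mulrC ler_pdivrMr ?expR_gt0// => /le_trans; apply.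
rewrite ler_pM ?mulr_ge0 ?expR_ge0 ?ler_wpM2l ?mulr_ge0// ler_expR.
by rewrite ler_wpM2l// /c addr_ge0.
Qed.

(** * Boundedness of the peridynamic operator *)

(** Translation invariance, from uniqueness given the values on intervals; it carries the essential
    bound on [C] over to y |-> C (y - x). *)
Lemma lebesgue_measure_shift (a : R) (A : set R) : measurable A ->
  pushforward mu ((fun y => y - a) : _ -> measurableTypeR R) A = mu A.
Proof.
move=> mA.
have ms : measurable_fun setT (fun y : R => y - a).
  by apply: measurable_funD => //; exact: measurable_cst.
apply/esym/lebesgue_measure_unique => //= _ [[x y]] _ <-.
rewrite /pushforward (_ : _ @^-1` _ = `]x + a, y + a]%classic); last first.
  by apply/seteqP; split=> z /=; rewrite !in_itv/= => /andP[? ?]; apply/andP; split; lra.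
rewrite !lebesgue_measure_itv/= !lte_fin ltrD2r.
by case: ifP => // _; rewrite -!EFinD; congr EFin; ring.
Qed.

Lemma ae_shift (a : R) (P : R -> Prop) :
  {ae mu, forall y, P y} -> {ae mu, forall y, P (y - a)}.
Proof.
move=> [A [mA A0 PA]].
have ms : measurable_fun setT (fun y : R => y - a).
  by apply: measurable_funD => //; exact: measurable_cst.
exists ((fun y => y - a) @^-1` A); split.
- by rewrite -[X in measurable X]setTI; exact: ms.
- by rewrite -A0 -[RHS](lebesgue_measure_shift a).
- by move=> y nP; apply: PA.
Qed.

(** The bound must hold on the whole line, since y - x leaves [D] for some x and y in [D]; vanishing
    outside [D] identifies [C] with its restriction. *)
Lemma Linfty_bound (C : R -> R) : (forall xi, ~ D xi -> C xi = 0) ->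
  in_Linfty M C -> measurable_fun setT C /\
  exists2 B : R, 0 <= B & {ae mu, forall y, `|C y| <= B}.
Proof.
move=> C0; rewrite /in_Linfty; have -> : C \_ D = C.
  apply/funext => x; rewrite patchE; case: ifPn => // /negP xD.
  by rewrite C0// => Dx; apply: xD; rewrite inE.
rewrite inE => /andP[]; rewrite !inE/= => mC.
rewrite /finite_norm unlock.
have mT : (0 < mu [set: R])%E.
  apply: (@lt_le_trans _ _ (mu D)).
    by rewrite [X in (_ < X)%E]lebesgue_domain lte_fin per_gt0.
  by apply: le_measure; rewrite ?inE//; exact: measurable_domain.
rewrite mT => ess; split; first exact: mC.
pose e := ess_sup mu (abse \o (EFin \o C)).
exists (Num.max 0 (fine e)); first by rewrite le_max lexx.
have := ess_sup_ge mu (abse \o (EFin \o C)).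
apply: filterS => x /=; rewrite -/e => Ce; rewrite le_max; apply/orP; right.
have ef : e \is a fin_num.
  by rewrite ge0_fin_numE//; apply: le_trans Ce.
by rewrite -lee_fin fineK.
Qed.

Lemma ae_le_integrable f g : measurable_fun D f ->
  (forall y, D y -> 0 <= g y) -> {ae mu, forall y, D y -> `|f y| <= g y} ->
  mu.-integrable D (EFin \o g) ->
  mu.-integrable D (EFin \o f) /\
  `|\int[mu]_(y in D) f y| <= \int[mu]_(y in D) g y.
Proof.
move=> mf g0 fg ig; have mD := measurable_domain.
have mg : measurable_fun D (EFin \o g) := measurable_int _ ig.
have mfE : measurable_fun D (EFin \o f) by apply/measurable_EFinP; exact: mf.
have le1 : (\int[mu]_(y in D) `|(EFin \o f) y| <= \int[mu]_(y in D) `|(EFin \o g) y|)%E.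
  apply: ae_ge0_le_integral => //.
  - exact: measurableT_comp.
  - exact: measurableT_comp.
  - apply: filterS fg; first exact: (ae_filter_ringOfSetsType mu).
    by move=> y /= fg Dy; rewrite lee_fin (le_trans (fg Dy))// ler_norm.
have iF : mu.-integrable D (EFin \o f).
  by apply/integrableP; split=> //; apply: le_lt_trans le1 _; case/integrableP : ig.
split=> //; apply: le_trans (le_normr_Rintegral mD iF) _.
rewrite /Rintegral fine_le//.
- by apply: (integrable_fin_num mD); have := integrable_norm iF.
- exact: (integrable_fin_num mD ig).
apply: ae_ge0_le_integral => //.
- by apply/measurable_EFinP; apply: measurableT_comp.
Qed.

(** Tonelli applied separately to the positive and negative parts requires no integrability of h. *)
Lemma measurable_param_integral (h : R * R -> R) : measurable_fun setT h ->
  measurable_fun setT (fun x => \int[mu]_(y in setT) h (x, y)).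
Proof.
move=> mh; rewrite /Rintegral.
apply: (@measurableT_comp _ _ _ _ _ _ fine) => //.
under eq_fun do rewrite integralE.
have mhE : measurable_fun setT (EFin \o h) by exact/measurable_EFinP.
apply: emeasurable_funB.
- have K := @measurable_fun_fubini_tonelli_F _ _ _ _ _ mu ((EFin \o h)^\+%E)
    (measurable_funepos mhE) (fun z => funepos_ge0 _ z).
  rewrite [X in measurable_fun _ X](_ : _ = fubini_F mu ((EFin \o h)^\+%E))//.
  by apply/funext => x; apply: eq_integral => y _; rewrite !funeposE.
- have K := @measurable_fun_fubini_tonelli_F _ _ _ _ _ mu ((EFin \o h)^\-%E)
    (measurable_funeneg mhE) (fun z => funeneg_ge0 _ z).
  rewrite [X in measurable_fun _ X](_ : _ = fubini_F mu ((EFin \o h)^\-%E))//.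
  by apply/funext => x; apply: eq_integral => y _; rewrite !funenegE.
Qed.

Lemma Rintegral_domain_cst (a : R) : \int[mu]_(x in D) a = per * a.
Proof.
rewrite Rintegral_cst; last exact: measurable_domain.
by rewrite mulrC; congr (_ * _); rewrite -[RHS]/(fine per%:E); congr fine; exact: lebesgue_domain.
Qed.

Section peridynamic_bound.
Variables (C : R -> R) (B : R).
Hypotheses (B_ge0 : 0 <= B) (measurable_C : measurable_fun setT C).
Hypothesis C_le : {ae mu, forall y, `|C y| <= B}.

Lemma measurable_shift_C x : measurable_fun setT (fun y : R => C (y - x)).
Proof.
apply: (measurableT_comp measurable_C).
by apply: measurable_funB => //; exact: measurable_cst.
Qed.

Lemma peridynamic_integrand f x : sqint f ->
  mu.-integrable D (EFin \o (fun y => C (y - x) * (f y - f x))) /\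
  `|peridynamic M C f x| <= \int[mu]_(y in D) (B * (`|f y| + `|f x|)).
Proof.
move=> sf; have [mf _] := sf.
apply: ae_le_integrable; last 1 first.
- apply: integrable_domainZ; apply: integrable_domainD; last exact: integrable_cst.
  by have := integrable_norm (sqint_integrable sf).
- apply: measurable_funM; first exact: measurable_funTS (measurable_shift_C x).
  by apply: measurable_funB => //; exact: measurable_cst.
- by move=> y _; rewrite mulr_ge0// addr_ge0.
- apply: filterS (ae_shift x C_le); first exact: (ae_filter_ringOfSetsType mu).
  move=> y /= Cy _; rewrite normrM ler_pM ?normr_ge0//.
  by rewrite (le_trans (ler_normB _ _)).
Qed.

Lemma peridynamicB f g x : sqint f -> sqint g ->
  peridynamic M C (fun y => f y - g y) x = peridynamic M C f x - peridynamic M C g x.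
Proof.
move=> sf sg; have [fi _] := peridynamic_integrand x sf.
have [gi _] := peridynamic_integrand x sg.
rewrite /peridynamic -RintegralB//; last exact: measurable_domain.
by apply: eq_Rintegral => y _; ring.
Qed.

Lemma measurable_peridynamic f : sqint f -> measurable_fun D (peridynamic M C f).
Proof.
move=> [mf _]; have mD := measurable_domain.
pose fD := f \_ D.
have mfD : measurable_fun setT fD.
  by apply: (measurable_restrictT _ _).1 => //; exact: measurable_domain.
(* A globally measurable integrand: f, measurable only on [D], is cut off, and the indicator turns
   the integral over [D] into one over the line. *)
pose h (z : R * R) := C (z.2 - z.1) * (fD z.2 - fD z.1) * \1_D z.2.
have mh : measurable_fun setT h.
  apply: measurable_funM; last first.
    exact: (measurableT_comp (measurable_indic mD) measurable_snd).
  apply: measurable_funM.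
    by apply: (measurableT_comp measurable_C); apply: measurable_funB.
  apply: measurable_funB.
    exact: (measurableT_comp mfD).
  exact: (measurableT_comp mfD).
apply: (@eq_measurable_fun _ _ _ _ _ (fun x => \int[mu]_(y in setT) h (x, y))).
  move=> x /set_mem Dx; rewrite /peridynamic [RHS]Rintegral_mkcond.
  apply: eq_Rintegral => y _; rewrite /h/= patchE indicE /fD !patchE (mem_set Dx).
  by case: ifPn => _; rewrite ?mulr1 ?mulr0.
by apply: measurable_funTS; exact: measurable_param_integral.
Qed.

(** Pointwise, |g f(x)| <= B (I1 + per |f(x)|), where I1 is the L^1 norm of f. Squaring costs a
    factor 2, and since I1^2 <= per I2, with I2 the integral of f^2, both terms contribute 2 B^2
    per^2 I2. *)
Lemma sqint_peridynamic f : sqint f ->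
  sqint (peridynamic M C f) /\
  \int[mu]_(x in D) (peridynamic M C f x ^+ 2) <=
    4 * B ^+ 2 * per ^+ 2 * \int[mu]_(x in D) (f x ^+ 2).
Proof.
move=> sf; have [mf f2] := sf; have mD := measurable_domain.
have per0 := per_gt0.
have ifn : mu.-integrable D (EFin \o (fun y => `|f y|)).
  by have := integrable_norm (sqint_integrable sf).
pose I1 := \int[mu]_(y in D) `|f y|; pose I2 := \int[mu]_(y in D) (f y ^+ 2).
have I12 : I1 ^+ 2 <= I2 * per.
  have sfn : sqint (fun y => `|f y|).
    split; first exact: measurableT_comp.
    by apply: eq_integrable_domain f2 => y _; rewrite real_normK// num_real.
  have := cauchy_schwarz sfn (sqint_cst 1).
  rewrite /= expr1n Rintegral_domain_cst mulr1 => /(_ per0).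
  rewrite (@eq_Rintegral _ _ _ mu D (fun y => `|f y|)); last by move=> y _; rewrite mulr1.
  rewrite -/I1 [X in X * per](_ : _ = I2)//.
  by apply: eq_Rintegral => y _; rewrite real_normK// num_real.
have ptw x : peridynamic M C f x ^+ 2 <= 2 * B ^+ 2 * (I1 ^+ 2 + per ^+ 2 * f x ^+ 2).
  have [_] := peridynamic_integrand x sf.
  rewrite RintegralZl//; last first.
    by apply: integrable_domainD => //; exact: integrable_cst.
  rewrite RintegralD//; last exact: integrable_cst.
  rewrite Rintegral_domain_cst -/I1 => h.
  have h2 : `|peridynamic M C f x| ^+ 2 <= (B * (I1 + per * `|f x|)) ^+ 2.
    by rewrite lerXn2r ?nnegrE ?(le_trans _ h).
  rewrite real_normK ?num_real// in h2; apply: le_trans h2 _.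
  rewrite [leRHS](_ : _ = B ^+ 2 * (2 * (I1 ^+ 2 + per ^+ 2 * f x ^+ 2))); last by ring.
  rewrite exprMn ler_wpM2l ?sqr_ge0//.
  rewrite -(real_normK (num_real (f x))) -exprMn sqrrD.
  by have := sqr_ge0 (I1 - per * `|f x|); rewrite sqrrB; lra.
have iF : mu.-integrable D (EFin \o (fun x => 2 * B ^+ 2 * (I1 ^+ 2 + per ^+ 2 * f x ^+ 2))).
  apply: integrable_domainZ; apply: integrable_domainD; first exact: integrable_cst.
  exact: integrable_domainZ.
have mP := measurable_peridynamic sf.
have iP : mu.-integrable D (EFin \o (fun x => peridynamic M C f x ^+ 2)).
  apply: (le_integrable_domain _ _ iF); first exact: measurable_funX.
  by move=> x _; rewrite ger0_norm ?sqr_ge0.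
split; first by [].
apply: (le_trans (le_Rintegral mD iP iF (fun x _ => ptw x))).
rewrite RintegralZl//; last first.
  by apply: integrable_domainD; [exact: integrable_cst|exact: integrable_domainZ].
rewrite RintegralD//; [|exact: integrable_cst|exact: integrable_domainZ].
rewrite RintegralZl// Rintegral_domain_cst -/I2.
have B2 : 0 <= 2 * B ^+ 2 by rewrite mulr_ge0// sqr_ge0.
have : per * I1 ^+ 2 <= per * (I2 * per) by rewrite ler_pM2l.
move: per per0 I12 => P P0 I12 h.
have : 2 * B ^+ 2 * (P * I1 ^+ 2 + P ^+ 2 * I2) <= 2 * B ^+ 2 * (P * (I2 * P) + P ^+ 2 * I2).
  by rewrite ler_wpM2l// lerD2r.
by move=> /le_trans; apply; rewrite le_eqVlt; apply/orP; left; apply/eqP; ring.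
Qed.

End peridynamic_bound.

(** * Error estimate *)

Lemma has_slopeB T h h' t l l' : has_slope T h t l -> has_slope T h' t l' ->
  has_slope T (fun tau => h tau - h' tau) t (l - l').
Proof.
move=> hl hl'; rewrite /has_slope.
rewrite (_ : (fun tau => _) = (fun tau => (h tau - h t) / (tau - t) -
  (h' tau - h' t) / (tau - t))); last by apply/funext => tau; ring.
by apply: cvgB.
Qed.

Lemma eq_has_slope T h h' t l : t \in `[0, T] ->
  (forall tau, tau \in `[0, T] -> h tau = h' tau) ->
  has_slope T h t l -> has_slope T h' t l.
Proof.
move=> tT hh'; apply: cvg_trans; apply: near_eq_cvg.
by apply: near_within => tau tauT _; rewrite !hh'.
Qed.

Lemma ddt_spec T u t : time_differentiable M T u -> t \in `[0, T] ->
  sqint (ddt M T u t) /\ is_time_derivative (L2norm M) T u t (ddt M T u t).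
Proof.
move=> du tT; pose Q := [set w | in_L2 M w /\ is_time_derivative (L2norm M) T u t w].
have [w1 w2] : Q (ddt M T u t).
  by apply: (@xgetPex _ (fun=> 0) Q); have [w ? ?] := du _ tT; exists w.
by split=> //; exact/in_L2P.
Qed.

Lemma time_differentiableB T u v :
  (forall t, t \in `[0, T] -> sqint (u t)) -> (forall t, t \in `[0, T] -> sqint (v t)) ->
  time_differentiable M T u -> time_differentiable M T v ->
  time_differentiable M T (fun t x => u t x - v t x).
Proof.
move=> su sv du dv t tT; have [su' du'] := ddt_spec du tT.
have [sv' dv'] := ddt_spec dv tT.
exists (fun x => ddt M T u t x - ddt M T v t x); first exact/in_L2P/sqintB.
exact: time_derivativeB.
Qed.

(** [ddt] picks representatives and is not additive pointwise; its coefficients are determined as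
    unique slopes, and those are additive. *)
Lemma hcoef_ddtB T u v t k : 0 < T ->
  (forall t, t \in `[0, T] -> sqint (u t)) -> (forall t, t \in `[0, T] -> sqint (v t)) ->
  time_differentiable M T u -> time_differentiable M T v -> t \in `[0, T] ->
  hcoef (ddt M T (fun t x => u t x - v t x) t) k =
  hcoef (ddt M T u t) k - hcoef (ddt M T v t) k.
Proof.
move=> T0 su sv du dv tT; have [su' du'] := ddt_spec du tT.
have [sv' dv'] := ddt_spec dv tT.
have [sd' dd'] := ddt_spec (time_differentiableB su sv du dv) tT.
have sd tau : tau \in `[0, T] -> sqint (fun x => u tau x - v tau x).
  by move=> tauT; apply: sqintB; [exact: su|exact: sv].
have s1 := hcoef_has_slope (k := k) sd tT sd' dd'.
apply: (has_slope_unique T0 tT s1); apply: eq_has_slope (has_slopeB (hcoef_has_slope (k := k) su tT su' du')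
  (hcoef_has_slope (k := k) sv tT sv' dv')) => // tau tauT.
by rewrite hcoefB//; [exact: su|exact: sv].
Qed.

(** Applied to the high modes of a curve in S_N: the derivative has the slope of the zero function
    as its coefficient. *)
Lemma hcoef_time_derivative_eq0 T u t k : 0 < T -> t \in `[0, T] ->
  (forall t, t \in `[0, T] -> sqint (u t)) -> time_differentiable M T u ->
  (forall t, t \in `[0, T] -> hcoef (u t) k = 0) -> hcoef (ddt M T u t) k = 0.
Proof.
move=> T0 tT su du u0; have [su' du'] := ddt_spec du tT.
have s1 := hcoef_has_slope (k := k) su tT su' du'.
apply: (has_slope_unique T0 tT s1).
apply: (@eq_has_slope _ (fun=> 0)) => // [tau tauT|]; first by rewrite u0.
rewrite /has_slope; under eq_fun do rewrite subrr mul0r; exact: cvg_cst.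
Qed.

(** * Truncation and weighted tails *)

Lemma eq_sumZ_in n F G : (forall k, (`|k| <= n)%N -> F k = G k) ->
  sumZ n F = sumZ n G.
Proof.
move=> FG; apply: eq_bigr => j _; apply: FG.
by have := ltn_ord j; lia.
Qed.

Lemma sumZ_trunc_le n m F : (forall k, 0 <= F k) ->
  sumZ n (fun k => if (`|k| <= m)%N then F k else 0) <= sumZ m F.
Proof.
move=> F0; rewrite -(@eq_sumZ_in m (fun k => if (`|k| <= m)%N then F k else 0)).
  by apply: sumZ_supp_le => k; [case: ifP|rewrite ltnNge => /negbTE ->].
by move=> k ->.
Qed.

Lemma weight_le k l : (`|k| <= `|l|)%N -> weight k <= weight l.
Proof.
move=> kl; rewrite lerD2l !expr_div_n ler_pM2r ?invr_gt0 ?exprn_gt0//.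
rewrite -[leLHS]real_normK ?num_real// -[leRHS]real_normK ?num_real//.
by rewrite lerXn2r ?nnegrE// -!intr_norm ler_int; lia.
Qed.

Lemma weight_gt0 k : 0 < weight k.
Proof. exact: lt_le_trans ltr01 (weight_ge1 k). Qed.

Lemma powR_nonincreasing (x y r : R) : 0 < x -> x <= y -> r <= 0 ->
  y `^ r <= x `^ r.
Proof.
move=> x0 xy r0; have y0 : 0 < y by exact: lt_le_trans xy.
rewrite -[r]opprK !(powRN _ (- r)) lef_pV2 ?posrE ?powR_gt0//.
by rewrite ge0_ler_powR ?nnegrE ?oppr_ge0// ltW.
Qed.

(** Splitting off the exponent r - s <= 0, whose power decreases in the weight. The case r = 0 gives
    the L^2 tail, r = 1 the H^1 tail. *)
Lemma weight_tail (s r : R) k (N : nat) : r <= s -> (N <= `|k|)%N ->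
  weight k `^ r <= weight N%:Z `^ (r - s) * weight k `^ s.
Proof.
move=> rs Nk; have w0 := weight_gt0 k; have wN := weight_gt0 N%:Z.
rewrite -{1}(subrK s r) [leLHS]powRD; last by apply/implyP => _; rewrite gt_eqF.
rewrite ler_wpM2r ?powR_ge0//; apply: powR_nonincreasing => //.
  by apply: weight_le; rewrite absz_nat.
by rewrite subr_le0.
Qed.

Section error_estimate.
Variables (T rho s B A : R) (C : R -> R) (b u uN : R -> R -> R) (u0 v0 : R -> R).
Variable N : nat.
Hypotheses (T_gt0 : 0 < T) (rho_gt0 : 0 < rho) (s_ge1 : 1 <= s) (B_ge0 : 0 <= B).
Hypothesis measurable_C : measurable_fun setT C.
Hypothesis C_le : {ae mu, forall y, `|C y| <= B}.
Hypothesis sqint_b : forall t, t \in `[0, T] -> sqint (b t).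
Hypotheses (sqint_u0 : sqint u0) (sqint_v0 : sqint v0).
Hypothesis u_sol : peridynamic_solution M T rho s C b u0 v0 u.
Hypothesis uN_sol : spectral_solution M T rho C b u0 v0 N uN.
(** [A] plays the squared X_s norm of [u], in the form supplied by [Hnorm_sqrD_le]. *)
Hypothesis A_bound : forall t, t \in `[0, T] -> forall n,
  per * sumZ n (fun k => weight k `^ s *
    (hcoef (u t) k ^+ 2 + hcoef (ddt M T u t) k ^+ 2)) <= A.

Let d t x := u t x - uN t x.
(** Differences of coefficients rather than coefficients of differences, so that slopes subtract
    directly; [hcoef_d] and [hcoef_dd] reconcile the two for [e] and [de]. *)
Let e k t := hcoef (u t) k - hcoef (uN t) k.
Let de k t := hcoef (ddt M T u t) k - hcoef (ddt M T uN t) k.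
Let dde k t :=
  hcoef (ddt M T (ddt M T u) t) k - hcoef (ddt M T (ddt M T uN) t) k.

Let su t : t \in `[0, T] -> sqint (u t).
Proof. by case: u_sol => -[hu _ _ _] _ /hu[/in_L2P]. Qed.

Let Su t : t \in `[0, T] -> in_S M N (uN t).
Proof. by case: uN_sol => hu _; exact: hu. Qed.

Let suN t : t \in `[0, T] -> sqint (uN t).
Proof. by move=> /Su; exact: sqint_in_S. Qed.

Let du : time_differentiable M T u. Proof. by case: u_sol => _ []. Qed.
Let ddu : time_differentiable M T (ddt M T u). Proof. by case: u_sol => _ []. Qed.
Let duN : time_differentiable M T uN. Proof. by case: uN_sol => _ []. Qed.
Let dduN : time_differentiable M T (ddt M T uN). Proof. by case: uN_sol => _ []. Qed.

Let sdu t : t \in `[0, T] -> sqint (ddt M T u t).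
Proof. by move=> tT; have [] := ddt_spec du tT. Qed.

Let sduN t : t \in `[0, T] -> sqint (ddt M T uN t).
Proof. by move=> tT; have [] := ddt_spec duN tT. Qed.

Let sd t : t \in `[0, T] -> sqint (d t).
Proof. by move=> tT; apply: sqintB; [exact: su|exact: suN]. Qed.

Let hcoef_d t k : t \in `[0, T] -> hcoef (d t) k = e k t.
Proof. by move=> tT; apply: hcoefB; [exact: su|exact: suN]. Qed.

Let hcoef_dd t k : t \in `[0, T] -> hcoef (ddt M T d t) k = de k t.
Proof. by move=> tT; exact: hcoef_ddtB. Qed.

Let e_tail t k : t \in `[0, T] -> (N < `|k|)%N -> e k t = hcoef (u t) k.
Proof. by move=> tT kN; rewrite /e (hcoef_in_S (Su tT) kN) subr0. Qed.

Let de_tail t k : t \in `[0, T] -> (N < `|k|)%N -> de k t = hcoef (ddt M T u t) k.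
Proof.
move=> tT kN; rewrite /de [X in _ - X](_ : _ = 0) ?subr0//.
by apply: hcoef_time_derivative_eq0 => // t' t'T; apply: hcoef_in_S kN; exact: Su.
Qed.

Let acceleration t k : t \in `[0, T] -> (`|k| <= N)%N ->
  rho * dde k t = hcoef (peridynamic M C (d t)) k.
Proof.
move=> tT kN.
have [sddu _] := ddt_spec ddu tT; have [sdduN _] := ddt_spec dduN tT.
have [sgu _] := sqint_peridynamic B_ge0 measurable_C C_le (su tT).
have [sguN _] := sqint_peridynamic B_ge0 measurable_C C_le (suN tT).
have sP f : sqint f -> sqint (P_ M N f) by move=> sf; exact: sqint_in_S (in_S_P N sf).
have sbt := sqint_b tT.
have hu : rho * hcoef (ddt M T (ddt M T u) t) k =
    hcoef (peridynamic M C (u t)) k + hcoef (b t) k.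
  rewrite -hcoefZ// -hcoefD//; apply: ae_hcoef; [exact: sqintZ|exact: sqintD|].
  by case: u_sol => _ [_ _ h _ _]; exact: h.
have huN : rho * hcoef (ddt M T (ddt M T uN) t) k =
    hcoef (peridynamic M C (uN t)) k + hcoef (b t) k.
  have e1 := hcoef_P N k sguN; have e2 := hcoef_P N k sbt; rewrite kN in e1 e2.
  rewrite -e1 -e2 -hcoefZ// -hcoefD//; [|exact: sP|exact: sP].
  apply: ae_hcoef; [exact: sqintZ|by apply: sqintD; exact: sP|].
  by case: uN_sol => _ [_ _ h _ _]; exact: h.
have -> : rho * dde k t =
    hcoef (peridynamic M C (u t)) k - hcoef (peridynamic M C (uN t)) k.
  have sub_eq (r a1 a2 p q z : R) : r * a1 = p + z -> r * a2 = q + z ->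
      r * (a1 - a2) = p - q.
    by move=> h1 h2; rewrite mulrBr h1 h2; ring.
  exact: sub_eq hu huN.
rewrite -(hcoefB k sgu sguN); apply: eq_hcoef => x _.
by rewrite (peridynamicB B_ge0 measurable_C C_le x (su tT) (suN tT)).
Qed.

Let A_ge0 : 0 <= A.
Proof.
have T0 : 0 \in `[0, T] by rewrite in_itv/= lexx ltW.
apply: le_trans (A_bound T0 0); rewrite mulr_ge0 ?(ltW per_gt0)// sumZ_ge0// => k.
by rewrite mulr_ge0 ?powR_ge0// addr_ge0 ?sqr_ge0.
Qed.

Let A_bound_u t n : t \in `[0, T] ->
  sumZ n (fun k => weight k `^ s * hcoef (u t) k ^+ 2) <= A / per.
Proof.
move=> tT; rewrite ler_pdivlMr ?per_gt0// mulrC; apply: le_trans (A_bound tT n).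
rewrite ler_pM2l ?per_gt0//; apply: le_sumZ => k.
by rewrite ler_wpM2l ?powR_ge0// lerDl sqr_ge0.
Qed.

(** Bound on the sum of the squared coefficients of [u t] above frequency N. *)
Let kappa : R := weight N%:Z `^ (- s) * (A / per).

Let kappa_ge0 : 0 <= kappa.
Proof. by rewrite mulr_ge0 ?powR_ge0// divr_ge0 ?A_ge0// ltW// per_gt0. Qed.

Let L2_error t : t \in `[0, T] ->
  \int[mu]_(x in D) (d t x ^+ 2) <= per * (sumZ N (fun k => e k t ^+ 2) + kappa).
Proof.
move=> tT.
(* This H^1 bound varies with t and N, which is harmless: it does not appear in the conclusion of
   [parseval_le]. Its tail part uses s >= 1. *)
apply: (parseval_le (A := sumZ N (fun k => weight k * e k t ^+ 2) + A / per)).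
- exact: sd.
- move=> n; apply: le_trans (lerD (sumZ_trunc_le n N _) (A_bound_u n tT)).
    rewrite -sumZD; apply: le_sumZ => k; rewrite hcoef_d//.
    case: leqP => kN; first by rewrite lerDl mulr_ge0 ?powR_ge0 ?sqr_ge0.
    rewrite add0r e_tail// ler_wpM2r ?sqr_ge0// -[leLHS]powRr1 ?(ltW (weight_gt0 k))//.
    by rewrite ler_powR// weight_ge1.
  by move=> k; rewrite mulr_ge0 ?sqr_ge0// ltW// weight_gt0.
- move=> n; rewrite ler_pM2l ?per_gt0//.
  apply: (@le_trans _ _ (sumZ n (fun k => (if (`|k| <= N)%N then e k t ^+ 2 else 0) +
     weight N%:Z `^ (- s) * (weight k `^ s * hcoef (u t) k ^+ 2)))).
    apply: le_sumZ => k; rewrite hcoef_d//.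
    case: leqP => kN.
      by rewrite lerDl mulr_ge0 ?powR_ge0// mulr_ge0 ?powR_ge0 ?sqr_ge0.
    rewrite add0r e_tail// mulrA -[leLHS]mul1r ler_wpM2r ?sqr_ge0//.
    have := @weight_tail s 0 k N (le_trans ler01 s_ge1) (ltnW kN).
    by rewrite powRr0 sub0r.
  rewrite sumZD sumZZ; apply: lerD; last by rewrite ler_wpM2l ?powR_ge0 ?A_bound_u.
  by apply: sumZ_trunc_le => k; exact: sqr_ge0.
Qed.

(** The squared L^2 bound on g from [sqint_peridynamic], divided by rho^2; independent of N and of
    the data. *)
Let gamma : R := 4 * B ^+ 2 * per ^+ 2 / rho ^+ 2.

Let gamma_ge0 : 0 <= gamma.
Proof. by rewrite divr_ge0 ?sqr_ge0// mulr_ge0 ?sqr_ge0// mulr_ge0 ?sqr_ge0. Qed.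

Let dde_bound t : t \in `[0, T] ->
  sumZ N (fun k => dde k t ^+ 2) <= gamma * (sumZ N (fun k => e k t ^+ 2) + kappa).
Proof.
move=> tT; have rho2 : 0 < rho ^+ 2 by rewrite exprn_gt0.
have [sg gle] := sqint_peridynamic B_ge0 measurable_C C_le (sd tT).
rewrite -(ler_pM2l rho2) -sumZZ.
rewrite (@eq_sumZ_in N _ (fun k => hcoef (peridynamic M C (d t)) k ^+ 2)); last first.
  by move=> k kN; rewrite -acceleration// exprMn.
rewrite -(ler_pM2l per_gt0); apply: (le_trans (bessel N sg)); apply: (le_trans gle).
have G0 : 0 <= 4 * B ^+ 2 * per ^+ 2 by rewrite mulr_ge0 ?sqr_ge0// mulr_ge0 ?sqr_ge0.
apply: (le_trans (ler_wpM2l G0 (L2_error tT))).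
rewrite le_eqVlt; apply/orP; left; apply/eqP; rewrite /gamma; field.
by rewrite gt_eqF.
Qed.

Let slope_e k t : t \in `[0, T] -> has_slope T (e k) t (de k t).
Proof.
move=> tT; have [a1 a2] := ddt_spec du tT; have [a3 a4] := ddt_spec duN tT.
by apply: has_slopeB; apply: hcoef_has_slope.
Qed.

Let slope_de k t : t \in `[0, T] -> has_slope T (de k) t (dde k t).
Proof.
move=> tT; have [a1 a2] := ddt_spec ddu tT; have [a3 a4] := ddt_spec dduN tT.
by apply: has_slopeB; apply: hcoef_has_slope.
Qed.

Let T0 : 0 \in `[0, T]. Proof. by rewrite in_itv/= lexx ltW. Qed.

Let e_init k : (`|k| <= N)%N -> e k 0 = 0.
Proof.
move=> kN; have sPu := sqint_in_S (in_S_P N sqint_u0).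
have [_ [_ _ _ iu _]] := u_sol; have [_ [_ _ _ iuN _]] := uN_sol.
rewrite /e (ae_hcoef k (su T0) sqint_u0 iu) (ae_hcoef k (suN T0) sPu iuN).
by rewrite hcoef_P// kN subrr.
Qed.

Let de_init k : (`|k| <= N)%N -> de k 0 = 0.
Proof.
move=> kN; have sPv := sqint_in_S (in_S_P N sqint_v0).
have [_ [_ _ _ _ iu]] := u_sol; have [_ [_ _ _ _ iuN]] := uN_sol.
rewrite /de (ae_hcoef k (sdu T0) sqint_v0 iu) (ae_hcoef k (sduN T0) sPv iuN).
by rewrite hcoef_P// kN subrr.
Qed.

Let Gamma : R := gamma * T * expR ((2 + gamma) * T).

Let low_frequency_error t : t \in `[0, T] ->
  sumZ N (fun k => e k t ^+ 2 + de k t ^+ 2) <= Gamma * kappa.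
Proof.
move=> tT.
have := gronwall_energy T_gt0 gamma_ge0 kappa_ge0 slope_e slope_de e_init de_init
  dde_bound tT.
by move=> /le_trans; apply; rewrite le_eqVlt /Gamma; apply/orP; left; apply/eqP; ring.
Qed.

(** Below N the weight is at most that of N, and weight(N) kappa = weight(N)^(1-s) A / per, which
    gives the Gamma part; above N the error is [u] itself and [weight_tail] with r = 1 gives the
    1. *)
Lemma H1_error t n : t \in `[0, T] ->
  per * sumZ n (fun k => weight k `^ 1 *
    (hcoef (d t) k ^+ 2 + hcoef (ddt M T d t) k ^+ 2)) <=
  (1 + Gamma) * (weight N%:Z `^ (1 - s) * A).
Proof.
move=> tT; have wN := weight_gt0 N%:Z; have per0 := per_gt0.
pose E k := e k t ^+ 2 + de k t ^+ 2.
pose U k := hcoef (u t) k ^+ 2 + hcoef (ddt M T u t) k ^+ 2.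
have E0 k : 0 <= E k by rewrite addr_ge0 ?sqr_ge0.
have U0 k : 0 <= U k by rewrite addr_ge0 ?sqr_ge0.
have low : sumZ n (fun k => if (`|k| <= N)%N then weight N%:Z * E k else 0) <=
    weight N%:Z * (Gamma * kappa).
  apply: le_trans (sumZ_trunc_le n N _) _ => [k|]; first by rewrite mulr_ge0// ltW.
  by rewrite sumZZ ler_pM2l//; exact: low_frequency_error.
have high : sumZ n (fun k => weight N%:Z `^ (1 - s) * (weight k `^ s * U k)) <=
    weight N%:Z `^ (1 - s) * (A / per).
  rewrite sumZZ ler_wpM2l ?powR_ge0// ler_pdivlMr// mulrC; exact: A_bound.
have ptw k : weight k `^ 1 * (hcoef (d t) k ^+ 2 + hcoef (ddt M T d t) k ^+ 2) <=
    (if (`|k| <= N)%N then weight N%:Z * E k else 0) +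
    weight N%:Z `^ (1 - s) * (weight k `^ s * U k).
  rewrite hcoef_d// hcoef_dd// -/(E k); case: leqP => kN.
    rewrite powRr1 ?(ltW (weight_gt0 k))//.
    apply: (@le_trans _ _ (weight N%:Z * E k)).
      by rewrite ler_wpM2r//; apply: weight_le; rewrite absz_nat.
    by rewrite lerDl !mulr_ge0 ?powR_ge0.
  rewrite add0r mulrA /E e_tail// de_tail// -/(U k) ler_wpM2r//.
  by apply: weight_tail => //; exact: ltnW.
have h : sumZ n (fun k => weight k `^ 1 *
    (hcoef (d t) k ^+ 2 + hcoef (ddt M T d t) k ^+ 2)) <=
    weight N%:Z * (Gamma * kappa) + weight N%:Z `^ (1 - s) * (A / per).
  by apply: le_trans (le_sumZ n ptw) _; rewrite sumZD; exact: lerD low high.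
rewrite -(ler_pM2l per0) in h; apply: (le_trans h).
have w1 : weight N%:Z `^ (1 - s) = weight N%:Z * weight N%:Z `^ (- s).
  rewrite powRD; last by apply/implyP => _; rewrite gt_eqF.
  by rewrite powRr1// ltW.
rewrite le_eqVlt; apply/orP; left; apply/eqP; rewrite /kappa w1.
by move: per per0 => P P0; field; rewrite gt_eqF.
Qed.

End error_estimate.

End periodic_domain.

(** * From coefficient bounds to the norms of the statement *)

Theorem theorem3 (R : realType) (M rho s : R) (C : R -> R)
  (M_gt0 : 0 < M) (rho_gt0 : 0 < rho) (s_ge1 : 1 <= s)
  (C_ge0 : forall xi, 0 <= C xi)
  (C_even : forall xi, C (- xi) = C xi)
  (C_out : forall xi, ~ domain M xi -> C xi = 0)
  (C_Linfty : in_Linfty M C) :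
  forall T : R, 0 < T ->
  exists L : R,
  forall N : nat, (0 < N)%N -> ~~ odd N ->
  forall b : R -> R -> R,
    (forall t, t \in `[0, T] -> in_L2 M (b t)) ->
    time_continuous (L2norm M) T b ->
  forall u0 v : R -> R, in_H M s u0 -> in_H M s v ->
  forall u uN : R -> R -> R,
    peridynamic_solution M T rho s C b u0 v u ->
    spectral_solution M T rho C b u0 v N uN ->
  (Xnorm M T 1 (fun t x => u t x - uN t x)%R
     <= (L * N%:R `^ (1 - s))%:E * Xnorm M T s u)%E.
Proof.
move=> T T_gt0; have [mC [B B0 CB]] := Linfty_bound M_gt0 C_out C_Linfty.
pose gamma := 4 * B ^+ 2 * (2 * M * pi) ^+ 2 / rho ^+ 2.
pose Gamma := gamma * T * expR ((2 + gamma) * T).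
have gamma0 : 0 <= gamma.
  by rewrite divr_ge0 ?sqr_ge0// mulr_ge0 ?sqr_ge0// mulr_ge0 ?sqr_ge0.
have Gamma0 : 0 <= Gamma by rewrite mulr_ge0 ?expR_ge0// mulr_ge0// ltW.
(* Square root of the constant in [H1_error]; M^(s-1) comes from replacing weight(N) by the smaller
   (N/M)^2 under the nonpositive exponent 1 - s. *)
exists (Num.sqrt (1 + Gamma) * M `^ (s - 1)).
move=> N N0 _ b bL2 _ u0 v [u0L _] [vL _] u uN us uNs.
pose K := Num.sqrt (1 + Gamma) * M `^ (s - 1) * N%:R `^ (1 - s).
rewrite -/K; have NR0 : 0 < N%:R :> R by rewrite ltr0n.
have K0 : 0 < K by rewrite !mulr_gt0 ?sqrtr_gt0 ?powR_gt0// ltr_wpDr.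
have T0 : 0 \in `[0, T] by rewrite in_itv/= lexx ltW.
pose d t x := u t x - uN t x.
pose Sd := ereal_sup [set (Hnorm M 1 (d t) `^ 2 + Hnorm M 1 (ddt M T d t) `^ 2)%E
  | t in `[0, T]].
pose Su := ereal_sup [set (Hnorm M s (u t) `^ 2 + Hnorm M s (ddt M T u t) `^ 2)%E
  | t in `[0, T]].
have sup_ge0 r w : (0 <= ereal_sup [set (Hnorm M r (w t) `^ 2 +
    Hnorm M r (ddt M T w t) `^ 2)%E | t in `[0%R, T]])%E.
  set S := (X in ereal_sup X).
  have S0 : S (Hnorm M r (w 0%R) `^ 2 + Hnorm M r (ddt M T w 0%R) `^ 2)%E by exists 0.
  by apply: le_trans (ereal_sup_ubound S0); rewrite adde_ge0// poweR_ge0.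
rewrite -[Xnorm M T s u]/(Su `^ 2^-1)%E.
rewrite -[X in (X <= _)%E]/(Sd `^ 2^-1)%E.
have Su0 : (0 <= Su)%E := sup_ge0 s u; have Sd0 : (0 <= Sd)%E := sup_ge0 1 d.
(* An infinite norm of [u] makes the right-hand side infinite because K > 0, so finiteness of the
   supremum need not be derived from [in_X]. *)
have [SuE|Sufin] := eqVneq Su +oo%E.
  by rewrite SuE poweRyr ?invr_eq0// gt0_muley ?leey// lte_fin.
have [A A0 SuA] : exists2 A : R, 0 <= A & Su = A%:E.
  by move: Su0 Sufin; case: (Su) => [r| |]//= r0 _; exists r.
have us' := us; case: us' => -[hu _ _ _] [du _ _ _ _].
have A_bound t : t \in `[0, T] -> forall n, 2 * M * pi * sumZ n (fun k =>
    weight M k `^ s * (hcoef M (u t) k ^+ 2 + hcoef M (ddt M T u t) k ^+ 2)) <= A.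
  move=> tT; apply/(Hnorm_sqrD_le M_gt0).
  - by have [/in_L2P] := hu _ tT.
  - by have [] := ddt_spec du tT.
  by rewrite -SuA; apply: ereal_sup_ubound; exists t.
have SdK : (Sd <= (K ^+ 2 * A)%:E)%E.
  apply: ub_ereal_sup => _ [t tT <-].
  have suN t' : t' \in `[0, T] -> sqint M (uN t').
    by case: uNs => h _ /h; exact: sqint_in_S.
  have su t' : t' \in `[0, T] -> sqint M (u t').
    by move=> /hu[/in_L2P].
  have duN : time_differentiable M T uN by case: uNs => _ [].
  apply/(Hnorm_sqrD_le M_gt0).
  - by apply: sqintB; [exact: su|exact: suN].
  - by have [] := ddt_spec (time_differentiableB su suN du duN) tT.
  move=> n; have sb t' : t' \in `[0, T] -> sqint M (b t').
    by move=> /bL2 /in_L2P.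
  have := H1_error M_gt0 T_gt0 rho_gt0 s_ge1 B0 mC CB sb ((in_L2P _ _).1 u0L)
    ((in_L2P _ _).1 vL) us uNs A_bound n tT.
  move=> /le_trans; apply; rewrite mulrA ler_wpM2r//.
  have NM0 : 0 < N%:R / M by rewrite divr_gt0.
  have wN : weight M N%:Z `^ (1 - s) <= ((N%:R / M) ^+ 2) `^ (1 - s).
    apply: powR_nonincreasing; first by rewrite exprn_gt0.
      by rewrite lerDr.
    by rewrite subr_le0.
  have e : ((N%:R / M) ^+ 2) `^ (1 - s) = (M `^ (s - 1) * N%:R `^ (1 - s)) ^+ 2.
    rewrite expr2 powRM ?(ltW NM0)// -expr2 powRM ?invr_ge0 ?(ltW M_gt0)//.
    rewrite -(powR_inv1 (ltW M_gt0)) -powRrM mulN1r opprB mulrC//.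
  have KE : K ^+ 2 = (1 + Gamma) * (M `^ (s - 1) * N%:R `^ (1 - s)) ^+ 2.
    by rewrite /K -mulrA exprMn sqr_sqrtr// addr_ge0.
  by rewrite KE -e; apply: ler_wpM2l wN; rewrite addr_ge0.
have h12 : (0 : R) <= 2^-1 by rewrite invr_ge0.
have KA : ((K ^+ 2 * A)%:E `^ 2^-1 = K%:E * Su `^ 2^-1)%E.
  rewrite SuA EFinM poweRM ?lee_fin ?sqr_ge0//; congr (_ * _)%E.
  rewrite poweR_EFin; congr EFin; rewrite powR12_sqrt ?sqr_ge0// sqrtr_sqr.
  by rewrite gtr0_norm.
rewrite -KA; apply: gt0_ler_poweR => //.
- by rewrite in_itv/= Sd0 leey.
- by rewrite in_itv/= leey andbT lee_fin mulr_ge0 ?sqr_ge0.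
Qed.
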